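(* For a group $G$ let $\operatorname{Th}(G)$ denote its elementary theory. The following hold for the irreducible Artin groups of finite type $A_n$ ($n\ge 1$), $B_n$ ($n\ge 2$), $D_n$ ($n\ge 3$) and $I_2(n)$ ($n\geq 3$), where $m,n$ range over the admissible indices of the family in question. (1) $\operatorname{Th}(A_n)=\operatorname{Th}(A_m)$ if and only if $n=m$. (2) $\operatorname{Th}(B_n)=\operatorname{Th}(B_m)$ if and only if $n=m$. (3) $\operatorname{Th}(D_n)=\operatorname{Th}(D_m)$ if and only if $n=m$. (4) For the family $I_2(n)$: (a) if $m,n$ are odd, then $\operatorname{Th}(I_2(n))=\operatorname{Th}(I_2(m))$ if and only if $m=n$; (b) if $m,n$ are even, then $\operatorname{Th}(I_2(n))=\operatorname{Th}(I_2(m))$ if and only if $m=n$; (c) if $n$ is even, then $\operatorname{Th}(I_2(m))\neq\operatorname{Th}(I_2(n))$ for every $m>n$. Moreover, each of the assertions (1), (2), (3), (4)(a), (4)(b) and (4)(c) continues to hold if $\operatorname{Th}(G)$ is replaced throughout by its $(\forall\exists\forall)^1$ fragment, i.e. by the set of $(\forall\exists\forall)^1$ sentences that hold in $G$.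
   Context: The first-order language of groups is $(\cdot,{}^{-1},1)$. The elementary theory $\operatorname{Th}(G)$ of a group $G$ is the set of all first-order sentences in this language that hold in $G$. A sentence is of class $(\forall\exists\forall)^1$ if it has the form $\forall x\,\exists y\,\forall z\,\Psi(x,y,z)$ with $\Psi$ quantifier-free. A Coxeter matrix is a symmetric $r\times r$ matrix $C=(m_{i,j})$ with $m_{i,i}=1$ and $m_{i,j}\in\{2,3,\ldots,\infty\}$ for $i\ne j$. Its Coxeter diagram is the labelled graph with vertices $x_1,\ldots,x_r$ and an edge labelled $m_{i,j}$ between $x_i$ and $x_j$ ($i\neq j$) exactly when $m_{i,j}\ge 3$ (label omitted if $m_{i,j}=3$). Writing $\langle x,y\rangle^m$ for the alternating product $xyx\cdots$ of length $m$ starting with $x$, the Artin group of $C$ is $\langle x_1,\ldots,x_r\mid \langle x_i,x_j\rangle^{m_{i,j}}=\langle x_j,x_i\rangle^{m_{i,j}}\text{ for } i\neq j\rangle$ (no relation when $m_{i,j}=\infty$). It is of finite type if the Coxeter group $\langle x_1,\ldots,x_r\mid (x_ix_j)^{m_{i,j}}=1,\ m_{i,j}\neq\infty\rangle$ is finite, and irreducible if the diagram is connected. The symbols $A_n,B_n,D_n,I_2(n)$ denote the Artin groups of the following diagrams. $A_n$: the path $x_1,\ldots,x_n$ with all edges unlabelled (label 3). $B_n$: the path $x_1,\ldots,x_n$ with the edge $x_{n-1}x_n$ labelled $4$ and all other edges unlabelled. $D_n$: the path $x_1,\ldots,x_{n-1}$ together with a vertex $x_n$ joined only to $x_{n-2}$,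 all edges unlabelled. $I_2(n)$: two vertices joined by one edge labelled $n$. *)

(* Defs.v *)
From HB Require Import structures.
From mathcomp Require Import all_boot.
From mathcomp Require Import boolp classical_sets.

Set Implicit Arguments.
Unset Strict Implicit.
Unset Printing Implicit Defensive.

Local Open Scope group_scope.
Local Open Scope quotient_scope.

(* Terms and formulas are indexed by the number of free variables, which are
   de Bruijn indices: [Var ord0] refers to the innermost quantifier. *)

Inductive term (k : nat) : Type :=
  | Var of 'I_k
  | One
  | Mul of term k & term k
  | Inv of term k.
Arguments One {k}.

Inductive formula : nat -> Type :=
  | Eq k of term k & term k : formula k
  | Not k of formula k : formula k
  | And k of formula k & formula k : formula k
  | Or k of formula k & formula k : formula k
  | Imp k of formula k & formula k : formula k
  | Forall k of formula k.+1 : formula k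
  | Exists k of formula k.+1 : formula k.

Definition sentence := formula 0.

Fixpoint quantifier_free k (phi : formula k) : bool :=
  match phi with
  | Eq _ _ _ => true
  | Not _ p => quantifier_free p
  | And _ p q | Or _ p q | Imp _ p q => quantifier_free p && quantifier_free q
  | Forall _ _ | Exists _ _ => false
  end.

Section Semantics.
Variable G : groupType.

Fixpoint eval k (e : 'I_k -> G) (t : term k) : G :=
  match t with
  | Var i => e i
  | One => 1
  | Mul s t => eval e s * eval e t
  | Inv t => (eval e t)^-1
  end.

Definition extend k (e : 'I_k -> G) (x : G) (i : 'I_k.+1) : G :=
  oapp e x (unlift ord0 i).

Fixpoint holds k (phi : formula k) : ('I_k -> G) -> Prop :=
  match phi with
  | Eq _ s t => fun e => eval e s = eval e t
  | Not _ p => fun e => ~ holds p e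
  | And _ p q => fun e => holds p e /\ holds q e
  | Or _ p q => fun e => holds p e \/ holds q e
  | Imp _ p q => fun e => holds p e -> holds q e
  | Forall _ p => fun e => forall x, holds p (extend e x)
  | Exists _ p => fun e => exists x, holds p (extend e x)
  end.

(* A sentence has no free variable, so [e] is the empty assignment. *)
Definition Th : set sentence := [set phi | forall e, holds phi e].

End Semantics.

(* In [Psi], the indices 2, 1, 0 are the variables x, y, z respectively. *)
Definition AEA1 : set sentence :=
  [set phi | exists2 Psi : formula 3,
     quantifier_free Psi & phi = Forall (Exists (Forall Psi))].

Definition Th_AEA1 (G : groupType) : set sentence := Th G `&` AEA1.

(* The letter [(i, false)] is the generator i, and [(i, true)] its inverse. *)
Definition word (I : choiceType) : choiceType := seq (I * bool).

Definition inv_letter (I : choiceType) (a : I * bool) := (a.1, ~~ a.2).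
Definition inv_word (I : choiceType) (w : word I) : word I :=
  rev (map (@inv_letter I) w).

Section Presentation.
Variables (I : choiceType) (R : set (word I * word I)).

Inductive pres_eq : word I -> word I -> Prop :=
  | pres_refl u : pres_eq u u
  | pres_sym u v : pres_eq u v -> pres_eq v u
  | pres_trans v u w : pres_eq u v -> pres_eq v w -> pres_eq u w
  | pres_cat u u' v v' :
      pres_eq u u' -> pres_eq v v' -> pres_eq (u ++ v) (u' ++ v')
  | pres_cancel a : pres_eq [:: a; inv_letter a] [::]
  | pres_rel u v : R (u, v) -> pres_eq u v.

Lemma pres_equiv : equiv_class_of (fun u v => `[< pres_eq u v >]).
Proof.
split=> [u|u v|v u w].
- by apply/asboolP/pres_refl.
- by apply/asboolP/asboolP; apply: pres_sym.
- move=> /asboolP uv /asboolP vw; apply/asboolP; exact: pres_trans uv vw.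
Qed.

Canonical pres_equiv_rel := EquivRelPack pres_equiv.

Definition presented : Type := {eq_quot pres_equiv_rel}.
HB.instance Definition _ := Choice.on presented.
HB.instance Definition _ := Quotient.on presented.

Definition pres_class (u : word I) : presented := \pi_presented u.

Lemma pres_classP u v : pres_class u = pres_class v <-> pres_eq u v.
Proof.
by split=> [/eqmodP/asboolP | uv]; last by apply/eqmodP/asboolP.
Qed.

Lemma repr_class u : pres_eq (repr (pres_class u)) u.
Proof. by apply/pres_classP; exact: reprK. Qed.

Lemma pres_ind (P : presented -> Prop) :
  (forall u, P (pres_class u)) -> forall x, P x.
Proof. by move=> Pcl x; rewrite -[x]reprK; exact: Pcl. Qed.

Definition pres_mul (x y : presented) := pres_class (repr x ++ repr y).
Definition pres_inv (x : presented) := pres_class (inv_word (repr x)).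

Lemma pres_mulE u v :
  pres_mul (pres_class u) (pres_class v) = pres_class (u ++ v).
Proof. by apply/pres_classP/pres_cat; exact: repr_class. Qed.

Lemma inv_letterK : involutive (@inv_letter I).
Proof. by case=> i b; rewrite /inv_letter /= negbK. Qed.

Lemma inv_wordK : involutive (@inv_word I).
Proof.
move=> w; rewrite /inv_word map_rev revK -map_comp map_id_in // => a _ /=.
exact: inv_letterK.
Qed.

Lemma mul_inv_word w : pres_eq (w ++ inv_word w) [::].
Proof.
elim: w => [|a w IHw]; first exact: pres_refl.
rewrite (_ : _ ++ _ =
  [:: a] ++ ((w ++ inv_word w) ++ [:: inv_letter a])); last first.
  by rewrite /inv_word /= rev_cons -cats1 !catA.
apply: (pres_trans (v := [:: a] ++ ([::] ++ [:: inv_letter a]))).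
  by apply: pres_cat (pres_refl _) (pres_cat IHw (pres_refl _)).
exact: pres_cancel.
Qed.

Lemma pres_eq_inv u v : pres_eq u v -> pres_eq (inv_word u) (inv_word v).
Proof.
move=> uv; apply: (pres_trans (v := inv_word u ++ (v ++ inv_word v))).
  rewrite -[X in pres_eq X _]cats0.
  by apply: pres_cat (pres_refl _) (pres_sym (mul_inv_word _)).
rewrite catA -[X in pres_eq _ X]cat0s; apply: pres_cat (pres_refl _).
apply: (pres_trans (v := inv_word u ++ u)).
  by apply: pres_cat (pres_refl _) (pres_sym uv).
by rewrite -{2}[u]inv_wordK; exact: mul_inv_word.
Qed.

Lemma pres_invE u : pres_inv (pres_class u) = pres_class (inv_word u).
Proof. by apply/pres_classP/pres_eq_inv; exact: repr_class. Qed.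

Lemma pres_mulA : associative pres_mul.
Proof.
elim/pres_ind=> u; elim/pres_ind=> v; elim/pres_ind=> w.
by rewrite !pres_mulE catA.
Qed.

Lemma pres_mul1g : left_id (pres_class [::]) pres_mul.
Proof. by elim/pres_ind=> u; rewrite pres_mulE. Qed.

Lemma pres_mulg1 : right_id (pres_class [::]) pres_mul.
Proof. by elim/pres_ind=> u; rewrite pres_mulE cats0. Qed.

Lemma pres_mulgV : right_inverse (pres_class [::]) pres_inv pres_mul.
Proof.
elim/pres_ind=> u; rewrite pres_invE pres_mulE.
by apply/pres_classP; exact: mul_inv_word.
Qed.

Lemma pres_mulVg : left_inverse (pres_class [::]) pres_inv pres_mul.
Proof.
elim/pres_ind=> u; rewrite pres_invE pres_mulE -{2}[u]inv_wordK.
by apply/pres_classP; exact: mul_inv_word.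
Qed.

HB.instance Definition _ := isGroup.Build presented
  pres_mulA pres_mul1g pres_mulg1 pres_mulVg pres_mulgV.

End Presentation.

(* The universal property: a family of elements of a group satisfying the
   relations extends to a homomorphism from the presented group. *)
Section UniversalProperty.
Variables (I : choiceType) (R : set (word I * word I)).
Variables (H : groupType) (h : I -> H).

Definition eval_word (w : word I) : H :=
  foldr (fun a x => (if a.2 then (h a.1)^-1 else h a.1) * x) 1 w.

Lemma eval_word_cat u v : eval_word (u ++ v) = eval_word u * eval_word v.
Proof. by elim: u => [|a u IHu] /=; rewrite ?mul1g // IHu mulgA. Qed.

Lemma presented_universal :
  (forall u v, R (u, v) -> eval_word u = eval_word v) ->
  exists f : presented R -> H,
    {morph f : x y / x * y} /\
    (forall i, f (pres_class R [:: (i, false)]) = h i).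
Proof.
move=> Rh; have Rw u v : pres_eq R u v -> eval_word u = eval_word v.
  elim=> {u v} [|//|v u w _ -> _ ->|u u' v v' _ uu' _ vv'|[i b]|u v /Rh] //.
    by rewrite !eval_word_cat uu' vv'.
  by case: b => /=; rewrite mulg1 ?mulVg ?mulgV.
exists (fun x => eval_word (repr x)); split=> [x y|i].
  by rewrite -eval_word_cat; apply/Rw; exact: repr_class.
by rewrite (Rw _ _ (repr_class R _)) /= mulg1.
Qed.

End UniversalProperty.

Local Close Scope group_scope.

(* The entry [Some m] is the number m, and [None] is infinity. *)
Definition coxeter_matrix r (C : 'I_r -> 'I_r -> option nat) : Prop :=
  [/\ forall i j, C i j = C j i,
      forall i, C i i = Some 1
    & forall i j m, i != j -> C i j = Some m -> 1 < m].

(* The alternating product < x_i, x_j >^m. *)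
Fixpoint alternating r (i j : 'I_r) (m : nat) : word 'I_r :=
  if m is m'.+1 then (i, false) :: alternating j i m' else [::].

Definition artin_relations r (C : 'I_r -> 'I_r -> option nat) :
    set (word 'I_r * word 'I_r) :=
  [set uv | exists i j m, [/\ i != j, C i j = Some m &
     uv = (alternating i j m, alternating j i m)]].

Definition artin r (C : 'I_r -> 'I_r -> option nat) : groupType :=
  presented (artin_relations C).

(* The vertex x_k is the ordinal of value k - 1.  For i < j, [lab i j] is the
   label of the edge between i and j, or 2 if they are not joined. *)
Definition diagram r (lab : nat -> nat -> nat) (i j : 'I_r) : option nat :=
  Some (if i == j then 1 else lab (minn i j) (maxn i j)).

Lemma coxeter_diagram r lab :
  (forall i j, i < j < r -> 1 < lab i j) -> coxeter_matrix (@diagram r lab).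
Proof.
move=> lab_gt1; split=> [i j|i|i j m neq_ij].
- by rewrite /diagram eq_sym minnC maxnC.
- by rewrite /diagram eqxx.
rewrite /diagram (negPf neq_ij) => -[<-]; apply: lab_gt1.
case: (ltngtP i j) => [ij|ij|/val_inj eq_ij].
- by rewrite ij ltn_ord.
- by rewrite ij ltn_ord.
by rewrite eq_ij eqxx in neq_ij.
Qed.

Definition A_label (i j : nat) := if j == i.+1 then 3 else 2.

Definition B_label n (i j : nat) :=
  if j == i.+1 then (if j == n.-1 then 4 else 3) else 2.

Definition D_label n (i j : nat) :=
  if j == n.-1 then (if i == n - 3 then 3 else 2)
  else if j == i.+1 then 3 else 2.

Definition A_diagram n := @diagram n A_label.
Definition B_diagram n := @diagram n (B_label n).
Definition D_diagram n := @diagram n (D_label n).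
Definition I2_diagram n := @diagram 2 (fun _ _ => n).

Lemma coxeter_A n : coxeter_matrix (@A_diagram n).
Proof. by apply: coxeter_diagram => i j _; rewrite /A_label; case: ifP. Qed.

Lemma coxeter_B n : coxeter_matrix (@B_diagram n).
Proof.
by apply: coxeter_diagram => i j _; rewrite /B_label; do 2?case: ifP.
Qed.

Lemma coxeter_D n : coxeter_matrix (@D_diagram n).
Proof.
by apply: coxeter_diagram => i j _; rewrite /D_label; do 2?case: ifP.
Qed.

Lemma coxeter_I2 n : 2 < n -> coxeter_matrix (@I2_diagram n).
Proof. by move=> n_gt2; apply: coxeter_diagram => i j _; apply: ltnW. Qed.

Definition artin_A n : groupType := artin (@A_diagram n).
Definition artin_B n : groupType := artin (@B_diagram n).
Definition artin_D n : groupType := artin (@D_diagram n).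
Definition artin_I2 n : groupType := artin (@I2_diagram n).

(* Main.v *)
(* The sentence "for all x there is y such that, for all z, either y does not
   commute with x or x = y^k" states that every central element is a k-th power.

   In each of the groups the center is generated by a power z = c^N of a Coxeter
   element c, with N = n + 1 for A_n (n > 1), N = n for B_n, N = n - 1 or
   2 (n - 1) for D_n with n even or odd, and N = n or n / 2 for I_2(n) with n
     odd
   or even, so the sentence holds for k = N.  Conversely, if z = x^k then k
   divides 2 n or n / 2 for I_2(n) and n for B_n by counting letters, and k <= N
   for A_n and D_n: each pair of points (of signed points, for D_n) crosses
   twice in z (or in z^2), and an even number of times in a power x^L that
   fixes both points, whence k <= L; and small L can be found among the cycles
   of the permutation induced by x.

   To find the center, we show that the Artin monoid has the usual reduction
   lemma (if s u = t v then both sides are multiples of the lcm of s and t), by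
   induction on the length and the cube condition for three letters.  It follows
   that, the diagram being connected, the quasi-central divisors of central
   elements are the powers of the one of minimal length, and that the monoid
   embeds in the group.  So z and any central x are powers of a common element,
   and it remains to see that the exponent of z divides that of x; this is read
   off an action of the group. *)

From HB Require Import structures.
Require Import Defs.
From mathcomp Require Import all_boot.
From mathcomp Require Import ssralg ssrnum ssrint order.
From mathcomp Require Import boolp zify.

Set Implicit Arguments.
Unset Strict Implicit.
Unset Printing Implicit Defensive.

Import Order.TTheory.

Local Open Scope group_scope.
Local Open Scope quotient_scope.

(** * Monoids with a reduction lemma *)

Section GarsideMonoid.

(** Comparing two groups uses one half of the description of each: [k]-th roots of all central
    elements in one, an upper bound or a divisibility for [k] in the other. The delicate point about
    the center is that the shortest quasi-central root [D] need not be central, since it may permute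
    the letters. So [zeta] comes from an explicit computation with a Coxeter element, and its
    primitivity is tested numerically: if a central [x] satisfies x^b = zeta^a, an integer invariant
    that is additive on these powers gives b inv(x) = a inv(zeta). Additivity holds because an
    element commuting with the letters must fix the relevant points, up to sign in type D; where
    inv(zeta) is 2, the parity of crossings supplies the missing factor. For I_2(n), [D] is found
    directly instead. The diagram enters only locally: the reduction lemma asks for a condition on
    triples of letters, which span diagrams with labels 2, 3 and 4, and for two letters the
    condition is empty. Once every letter divides [zeta], an inverse letter can be traded for a
    denominator [zeta], so that questions about the group become equations in the monoid. *)

Definition divides (M : monoidType) (x y : M) := exists z, y = x * z.

Definition mcentral (M : monoidType) (x : M) := forall y, commute x y.

(** [C i j] is the complement of [g i] in the lcm of [g i] and [g j]. The hypothesis [reduction]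
    makes every common multiple factor through this lcm and, with [C i i = 1], contains the
    cancellation of a letter. *)
Variables (M : monoidType) (I : finType) (g : I -> M) (C : I -> I -> M).
Variable len : M -> nat.
Hypothesis lenM : forall x y, len (x * y) = (len x + len y)%N.
Hypothesis len_gen : forall i, len (g i) = 1%N.
Hypothesis genP : forall x, x = 1 \/ exists i y, x = g i * y.
Hypothesis compl_id : forall i, C i i = 1.
Hypothesis compl_neq1 : forall i j, i != j -> C i j <> 1.
Hypothesis compl_lcm : forall i j, g i * C i j = g j * C j i.
Hypothesis reduction : forall i j u v, g i * u = g j * v ->
  exists w, u = C i j * w /\ v = C j i * w.

Lemma len1 : len 1 = 0%N.
Proof. by have := lenM 1 1; rewrite mulg1; lia. Qed.

Lemma len_eq0 x : len x = 0%N -> x = 1.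
Proof. by case: (genP x) => [//|[i [y ->]]]; rewrite lenM len_gen. Qed.

Lemma monoid_ind (P : M -> Prop) :
  P 1 -> (forall i x, P x -> P (g i * x)) -> forall x, P x.
Proof.
move=> P1 PM x; have [n] := ubnP (len x); elim: n x => // n IHn x.
case: (genP x) => [->//|[i [y ->]]]; rewrite lenM len_gen => lt_n.
by apply/PM/IHn; lia.
Qed.

Lemma gen_mulI i u v : g i * u = g i * v -> u = v.
Proof. by move=> /reduction[w]; rewrite compl_id !mul1g => -[-> ->]. Qed.

Lemma monoid_mulI (x u v : M) : x * u = x * v -> u = v.
Proof.
elim/monoid_ind: x => [|i x IHx]; first by rewrite !mul1g.
by rewrite -!mulgA => /gen_mulI/IHx.
Qed.

(** Lcms are not known to exist, so one is built below the two common multiples [p] and [q] at once,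
    by induction on the length of [p]. By [reduction], [p] and [q] pass through the lcm of the first
    letters of [x] and [y]; the rest is tiled by three smaller instances, one on each side and one
    for the two residues. *)
Lemma common_divisor_lcm (x y p q : M) :
    divides x p -> divides y p -> divides x q -> divides y q ->
  exists l, [/\ divides x l, divides y l, divides l p & divides l q].
Proof.
have [n] := ubnP (len p); elim: n x y p q => // n IHn x y p q lt_n.
case: (genP x) => [->|[i [x' ->]]].
  by move=> _ yp _ yq; exists y; split=> //; [exists y|exists 1];
    rewrite ?mul1g ?mulg1.
case: (genP y) => [->|[j [y' ->]]].
  by move=> xp _ xq _; exists (g i * x'); split=> //;
    [exists 1|exists (g i * x')]; rewrite ?mul1g ?mulg1.
move=> -[p1 Ep] [p2]; rewrite Ep => Ep2 [q1 ->] [q2 Eq2].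
move: Ep2 Eq2; rewrite -!mulgA => Ep2 Eq2.
have [p3 [Ep1 {}Ep2]] := reduction Ep2; have [q3 [Eq1 {}Eq2]] := reduction Eq2.
have lenp : len p = (len (C i j) + len p3).+1.
  by rewrite Ep -mulgA Ep1 !lenM len_gen.
have lenp' : len p = (len (C j i) + len p3).+1.
  by rewrite Ep -mulgA Ep1 mulgA compl_lcm !lenM len_gen.
have [|||||l1 [xl1 [u1 Eu1] [p4 Ep4] [q4 Eq4]]] := IHn x' (C i j) (C i j * p3)
  (C i j * q3).
- by rewrite lenM; lia.
- by exists p1.
- by exists p3.
- by exists q1.
- by exists q3.
have [|||||l2 [yl2 [u2 Eu2] [p5 Ep5] [q5 Eq5]]] := IHn y' (C j i) (C j i * p3)
  (C j i * q3).
- by rewrite lenM; lia.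
- by exists p2.
- by exists p3.
- by exists q2.
- by exists q3.
have [|||||l3 [[a Ea] [b Eb] [p6 Ep6] [q6 Eq6]]] := IHn u1 u2 p3 q3.
- lia.
- by exists p4; apply: (@monoid_mulI (C i j)); rewrite mulgA -Eu1.
- by exists p5; apply: (@monoid_mulI (C j i)); rewrite mulgA -Eu2.
- by exists q4; apply: (@monoid_mulI (C i j)); rewrite mulgA -Eu1.
- by exists q5; apply: (@monoid_mulI (C j i)); rewrite mulgA -Eu2.
exists (g i * C i j * l3); split.
- case: xl1 => d Ed; exists (d * a).
  by rewrite Ea -!mulgA (mulgA (C i j)) -Eu1 Ed !mulgA.
- case: yl2 => d Ed; exists (d * b).
  by rewrite compl_lcm Eb -!mulgA (mulgA (C j i)) -Eu2 Ed !mulgA.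
- by exists p6; rewrite -!mulgA -Ep6 -Ep1.
- by exists q6; rewrite -!mulgA -Eq6 -Eq1.
Qed.

Lemma gen_inj i j : g i = g j -> i = j.
Proof.
rewrite -[g i]mulg1 -[g j]mulg1 => /reduction[w [Ew _]].
apply/eqP/contraT => /compl_neq1; case; apply: len_eq0.
by have := congr1 len Ew; rewrite lenM len1; lia.
Qed.

Definition quasi_central (p : M) := forall i, exists j, g i * p = p * g j.

Lemma central_quasi_central p : mcentral p -> quasi_central p.
Proof. by move=> pC i; exists i; rewrite pC. Qed.

(* The lcm [g j * C j i] of the atoms i and j has length at least 3, that is,
   i and j are joined in the Coxeter diagram, when [C j i] starts with
   [g i * g j]. *)
Hypothesis connected : forall S : I -> Prop, (exists i, S i) ->
  (forall i j, S i -> (exists x, C j i = g i * g j * x) -> S j) -> forall j, S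
    j.

(** The letters dividing [p] are closed under adjacency: if [p = g i * p'], then [g j * p] also
    begins with [g i], so [p] begins with [C j i], hence with [g i * g j], and [g j] divides [p'].
    As also [p = p' * g i'], [g j] divides [p]. *)
Lemma quasi_central_divides (p : M) i : quasi_central p -> p <> 1 -> divides (g
  i) p.
Proof.
move=> pQ p1; apply: (connected (S := fun i => divides (g i) p)) => [|{}i j].
  by case: (genP p) => // -[j [y ->]]; exists j; exists y.
move=> [p' Ep] [x Ex]; have [j' Ej'] := pQ j; have [i' Ei'] := pQ i.
have [w [Ew _]] : exists w, p = C j i * w /\ p' * g j' = C i j * w.
  by apply: reduction; rewrite Ej' {1}Ep mulgA.
have Ep' : p' = g j * (x * w).
  by apply: (@gen_mulI i); rewrite -Ep Ew Ex !mulgA.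
have -> : p = p' * g i'.
  by apply: (@gen_mulI i); rewrite mulgA -Ep.
by exists (x * w * g i'); rewrite Ep' !mulgA.
Qed.

Lemma ex_max_nat (P : nat -> Prop) n0 b : P n0 -> (forall n, P n -> n <= b)%N ->
  exists n, P n /\ forall k, P k -> (k <= n)%N.
Proof.
move=> Pn0 Pb.
have exP : exists n, `[< P n >] by exists n0; apply/asboolP.
have ubP n : `[< P n >] -> (n <= b)%N by move=> /asboolP/Pb.
case: (ex_maxnP exP ubP) => n /asboolP Pn max_n; exists n; split=> // k Pk.
by apply: max_n; apply/asboolP.
Qed.

(* A common divisor d of maximal length is a gcd; as s p = p s' and s q = q s'',
   s d and d both divide s p and s q, so their lcm is s d, and d divides s d. *)
Lemma quasi_central_gcd p q : quasi_central p -> quasi_central q ->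
    p <> 1 -> q <> 1 ->
  exists d, [/\ quasi_central d, d <> 1, divides d p & divides d q].
Proof.
move=> pQ qQ p1 q1.
pose P n := exists d, [/\ divides d p, divides d q & len d = n].
have [||n [[d [dp dq lend]] max_n]] := @ex_max_nat P 0%N (len p).
- by exists 1; split; [exists p|exists q|exact: len1]; rewrite mul1g.
- by move=> n [d [[z ->] _ <-]]; rewrite lenM leq_addr.
case: (genP p) => // -[i0 _].
exists d; split=> //.
  move=> i; have [||||l [[a Ea] dl]] := @common_divisor_lcm (g i * d) d (g i *
    p) (g i * q).
  - by case: dp => z ->; exists z; rewrite mulgA.
  - by have [j ->] := pQ i; case: dp => z ->; exists (z * g j); rewrite mulgA.
  - by case: dq => z ->; exists z; rewrite mulgA.
  - by have [j ->] := qQ i; case: dq => z ->; exists (z * g j); rewrite mulgA.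
  move=> [z Ez] [t Et].
  have /max_n : P (len (d * a)).
    exists (d * a); split=> //; [exists z|exists t];
    by apply: (@gen_mulI i); rewrite ?Ez ?Et Ea !mulgA.
  rewrite lenM lend => a0.
  have {}a0 : a = 1 by apply: len_eq0; lia.
  move: Ea; rewrite a0 mulg1; case: dl => y -> E.
  have : len (d * y) = len (g i * d) by rewrite E.
  rewrite !lenM len_gen => leny.
  case: (genP y) => [y1|[j [y' Ey]]].
    by move: leny; rewrite y1 len1; lia.
  suff y'1 : y' = 1 by exists j; rewrite -E Ey y'1 mulg1.
  by apply: len_eq0; move: leny; rewrite Ey lenM len_gen; lia.
move=> d1; suff : (1 <= n)%N by move: lend; rewrite d1 len1; lia.
apply: max_n; exists (g i0); split=> //; exact: quasi_central_divides.
Qed.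

(** Dividing a central element forces the map i -> j given by [g i * d = d * g j] to be a
    permutation of the letters; this is what keeps quotients quasi-central. *)
Definition central_divisor (d : M) :=
  quasi_central d /\ exists2 z, mcentral z & divides d z.

(** With [z = d * y], passing a letter through [y] undoes the map [f] that [d] induces on letters.
    So [f] is injective, and bijective because there are finitely many letters. *)
Lemma central_divisor_surj d : central_divisor d ->
  forall j, exists i, g i * d = d * g j.
Proof.
move=> [dQ [z zC [y Ez]]] j.
have [f Ef] := choice dQ.
have f_inj : injective f.
  move=> i i' eq_f; have Ef' i1 : g (f i1) * y = y * g i1.
    by apply: (@monoid_mulI d); rewrite mulgA -Ef -mulgA -Ez -zC Ez mulgA.
  have /monoid_mulI Eg : y * g i = y * g i' by rewrite -!Ef' eq_f.
  by apply: gen_inj.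
by have [f' _ f'K] := injF_bij f_inj; exists (f' j); rewrite Ef f'K.
Qed.

(** Descent: [D] is a shortest nontrivial central divisor, so its gcd with a nontrivial [p] can only
    be [D]; then [D] is split off from [p], and the quotient is again a central divisor. *)
Lemma central_divisor_powers (z0 : M) : mcentral z0 -> z0 <> 1 ->
  exists D, [/\ D <> 1, central_divisor D &
    forall p, central_divisor p -> exists n, p = D ^+ n].
Proof.
move=> z0C z01.
pose P n := exists d, [/\ d <> 1, central_divisor d & len d = n].
have exP : exists n, `[< P n >].
  exists (len z0); apply/asboolP; exists z0; split=> //.
  split; first exact: central_quasi_central.
  by exists z0 => //; exists 1; rewrite mulg1.
case: (ex_minnP exP) => n /asboolP[D [D1 Dcd lenD]] min_n.
exists D; split=> // p.
have [k] := ubnP (len p); elim: k p => // k IHk p lt_k [pQ [z zC pz]].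
have [->|p1] := pselect (p = 1); first by exists 0%N.
have [d [dQ d1 [a Da] [b pb]]] := quasi_central_gcd Dcd.1 pQ D1 p1.
have /asboolP/min_n : P (len d).
  exists d; split=> //; split=> //; exists z => //.
  by case: pz => c ->; exists (b * c); rewrite pb mulgA.
rewrite -lenD {1}Da lenM => lea.
have a1 : a = 1 by apply: len_eq0; lia.
move: Da pb; rewrite a1 mulg1 => <- pb.
have [||m Em] := IHk b; last by exists m.+1; rewrite pb Em expgS.
- suff : len D <> 0%N by move: lt_k; rewrite pb lenM; lia.
  by move=> /len_eq0.
split=> [j|].
  have [i Ei] := central_divisor_surj Dcd j; have [j' Ej'] := pQ i.
  exists j'; apply: (@monoid_mulI D).
  by rewrite mulgA -Ei -mulgA -pb Ej' pb mulgA.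
(* Centrality of [z] moves the factor [D] to the right end: [z = D * b * c] becomes
   [z = b * c * D]. *)
exists z => //; case: pz => c Ez; exists (c * D).
by apply: (@monoid_mulI D); rewrite -zC Ez pb !mulgA.
Qed.

Lemma central_common_root (p q : M) : mcentral p -> mcentral q ->
  exists D i j, p = D ^+ i /\ q = D ^+ j.
Proof.
have cd (z : M) : mcentral z -> central_divisor z.
  move=> zC; split; first exact: central_quasi_central.
  by exists z => //; exists 1; rewrite mulg1.
have [->|p1] := pselect (p = 1); first by move=> _ _; exists q, 0%N, 1%N.
move=> pC qC; have [D [_ _ Dpow]] := central_divisor_powers pC p1.
have [[i ->] [j ->]] := (Dpow p (cd p pC), Dpow q (cd q qC)).
by exists D, i, j.
Qed.

End GarsideMonoid.

(** * Artin monoids *)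

(** The identities of this kind, an [eql] and an [eqr] for each placement of [r] in A_3 or B_3, are
    the two equations demanded by [cube] for the words that word reversing produces. The prefix [x],
    later 1, lets every relation be rewritten in the form [y * r * s * ...] inside a product
    associated to the left. *)
Lemma cube_A3_mid_eql (M : monoidType) (r s t x : M) :
    r * s * r = s * r * s ->
    r * t * r = t * r * t ->
    s * t = t * s ->
  x * r * s * t * r * s =
  x * t * r * s * t * r.
Proof.
move=> Ers Ert Est.
have Ers' y : y * r * s * r = y * s * r * s.
  by rewrite -?mulgA; congr (_ * _); rewrite ?mulgA.
have Ert' y : y * r * t * r = y * t * r * t.
  by rewrite -?mulgA; congr (_ * _); rewrite ?mulgA.
have Est' y : y * s * t = y * t * s.
  by rewrite -?mulgA; congr (_ * _); rewrite ?mulgA.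
by rewrite (Est' (x * r)) -(Ers' (x * r * t)) (Ert' x)
  -(Est' (x * t * r)).
Qed.

Lemma cube_A3_mid_eqr (M : monoidType) (r s t x : M) :
    r * s * r = s * r * s ->
    r * t * r = t * r * t ->
    s * t = t * s ->
  x * r * t * s * r * t =
  x * s * r * s * t * r.
Proof.
move=> Ers Ert Est.
have Ers' y : y * r * s * r = y * s * r * s.
  by rewrite -?mulgA; congr (_ * _); rewrite ?mulgA.
have Ert' y : y * r * t * r = y * t * r * t.
  by rewrite -?mulgA; congr (_ * _); rewrite ?mulgA.
have Est' y : y * s * t = y * t * s.
  by rewrite -?mulgA; congr (_ * _); rewrite ?mulgA.
by rewrite -(Est' (x * r)) -(Ert' (x * r * s)) (Ers' x).
Qed.

Lemma cube_A3_end_eql (M : monoidType) (r s t x : M) :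
    r * s * r = s * r * s ->
    r * t = t * r ->
    s * t * s = t * s * t ->
  x * r * s * t * s * r =
  x * t * s * r * s * t.
Proof.
move=> Ers Ert Est.
have Ers' y : y * r * s * r = y * s * r * s.
  by rewrite -?mulgA; congr (_ * _); rewrite ?mulgA.
have Ert' y : y * r * t = y * t * r.
  by rewrite -?mulgA; congr (_ * _); rewrite ?mulgA.
have Est' y : y * s * t * s = y * t * s * t.
  by rewrite -?mulgA; congr (_ * _); rewrite ?mulgA.
by rewrite (Est' (x * r)) (Ert' x) -(Ert' (x * t * r * s))
  (Ers' (x * t)).
Qed.

Lemma cube_A3_end_eqr (M : monoidType) (r s t x : M) :
    r * s * r = s * r * s ->
    r * t = t * r ->
    s * t * s = t * s * t ->
  x * r * s * t * r * s =
  x * s * t * r * s * t.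
Proof.
move=> Ers Ert Est.
have Ers' y : y * r * s * r = y * s * r * s.
  by rewrite -?mulgA; congr (_ * _); rewrite ?mulgA.
have Ert' y : y * r * t = y * t * r.
  by rewrite -?mulgA; congr (_ * _); rewrite ?mulgA.
have Est' y : y * s * t * s = y * t * s * t.
  by rewrite -?mulgA; congr (_ * _); rewrite ?mulgA.
by rewrite -(Ert' (x * r * s)) (Ers' x) (Est' (x * s * r))
  (Ert' (x * s)).
Qed.

Lemma cube_B3_mid_eql (M : monoidType) (r s t x : M) :
    r * s * r = s * r * s ->
    r * t * r * t = t * r * t * r ->
    s * t = t * s ->
  x * r * s * t * r * t * s * r * t =
  x * t * r * s * t * r * t * s * r.
Proof.
move=> Ers Ert Est.
have Ers' y : y * r * s * r = y * s * r * s.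
  by rewrite -?mulgA; congr (_ * _); rewrite ?mulgA.
have Ert' y : y * r * t * r * t = y * t * r * t * r.
  by rewrite -?mulgA; congr (_ * _); rewrite ?mulgA.
have Est' y : y * s * t = y * t * s.
  by rewrite -?mulgA; congr (_ * _); rewrite ?mulgA.
by rewrite (Est' (x * r)) -(Est' (x * r * t * s * r)) -(Ers' (x * r * t))
  (Ert' (x * r * t * r * s)) (Est' (x * r * t * r)) (Ert' x)
  (Ers' (x * t * r * t)) (Est' (x * t * r * t * s * r)) -(Est' (x * t * r)).
Qed.

Lemma cube_B3_mid_eqr (M : monoidType) (r s t x : M) :
    r * s * r = s * r * s ->
    r * t * r * t = t * r * t * r ->
    s * t = t * s ->
  x * r * t * r * s * r * t * r * s =
  x * s * r * s * t * r * t * s * r.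
Proof.
move=> Ers Ert Est.
have Ers' y : y * r * s * r = y * s * r * s.
  by rewrite -?mulgA; congr (_ * _); rewrite ?mulgA.
have Ert' y : y * r * t * r * t = y * t * r * t * r.
  by rewrite -?mulgA; congr (_ * _); rewrite ?mulgA.
have Est' y : y * s * t = y * t * s.
  by rewrite -?mulgA; congr (_ * _); rewrite ?mulgA.
by rewrite (Ers' (x * r * t)) (Est' (x * r * t * s * r)) -(Ers' (x * r * t * s
  * r * t))
  -(Est' (x * r)) -(Ert' (x * r * s)) (Ers' x).
Qed.

Lemma cube_B3_end3_eql (M : monoidType) (r s t x : M) :
    r * s * r = s * r * s ->
    r * t = t * r ->
    s * t * s * t = t * s * t * s ->
  x * r * s * t * s * r * t * s * t =
  x * t * s * t * r * s * t * s * r.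
Proof.
move=> Ers Ert Est.
have Ers' y : y * r * s * r = y * s * r * s.
  by rewrite -?mulgA; congr (_ * _); rewrite ?mulgA.
have Ert' y : y * r * t = y * t * r.
  by rewrite -?mulgA; congr (_ * _); rewrite ?mulgA.
have Est' y : y * s * t * s * t = y * t * s * t * s.
  by rewrite -?mulgA; congr (_ * _); rewrite ?mulgA.
by rewrite (Ert' (x * r * s * t * s)) (Est' (x * r)) -(Ers' (x * r * t * s * t))
  (Ert' x) (Ert' (x * t * r * s * t * r * s)) -(Ert' (x * t * r * s))
  (Ers' (x * t)) (Est' (x * t * s * r)) (Ert' (x * t * s)).
Qed.

Lemma cube_B3_end3_eqr (M : monoidType) (r s t x : M) :
    r * s * r = s * r * s ->
    r * t = t * r ->
    s * t * s * t = t * s * t * s ->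
  x * r * s * t * s * r * s * t * s =
  x * s * t * s * r * s * t * s * r.
Proof.
move=> Ers Ert Est.
have Ers' y : y * r * s * r = y * s * r * s.
  by rewrite -?mulgA; congr (_ * _); rewrite ?mulgA.
have Ert' y : y * r * t = y * t * r.
  by rewrite -?mulgA; congr (_ * _); rewrite ?mulgA.
have Est' y : y * s * t * s * t = y * t * s * t * s.
  by rewrite -?mulgA; congr (_ * _); rewrite ?mulgA.
by rewrite -(Ers' (x * r * s * t)) (Ert' (x * r * s * t * r * s)) -(Ert' (x * r
  * s))
  (Ers' x) (Est' (x * s * r)) -(Ers' (x * s * r * t * s * t))
  (Ert' (x * s)) -(Ert' (x * s * t * r * s)) (Ers' (x * s * t)).
Qed.

Lemma cube_B3_end4_eql (M : monoidType) (r s t x : M) :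
    r * s * r * s = s * r * s * r ->
    r * t = t * r ->
    s * t * s = t * s * t ->
  x * r * s * r * t * s * r * s * t =
  x * t * s * r * s * r * t * s * r.
Proof.
move=> Ers Ert Est.
have Ers' y : y * r * s * r * s = y * s * r * s * r.
  by rewrite -?mulgA; congr (_ * _); rewrite ?mulgA.
have Ert' y : y * r * t = y * t * r.
  by rewrite -?mulgA; congr (_ * _); rewrite ?mulgA.
have Est' y : y * s * t * s = y * t * s * t.
  by rewrite -?mulgA; congr (_ * _); rewrite ?mulgA.
by rewrite (Ert' (x * r * s)) (Ers' (x * r * s * t)) (Ert' (x * r * s * t * s *
  r * s))
  (Est' (x * r)) (Ert' x) -(Ert' (x * t * r * s))
  -(Est' (x * t * r * s * r)) (Ers' (x * t)).
Qed.

Lemma cube_B3_end4_eqr (M : monoidType) (r s t x : M) :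
    r * s * r * s = s * r * s * r ->
    r * t = t * r ->
    s * t * s = t * s * t ->
  x * r * s * t * r * s * r * t * s =
  x * s * t * r * s * r * t * s * r.
Proof.
move=> Ers Ert Est.
have Ers' y : y * r * s * r * s = y * s * r * s * r.
  by rewrite -?mulgA; congr (_ * _); rewrite ?mulgA.
have Ert' y : y * r * t = y * t * r.
  by rewrite -?mulgA; congr (_ * _); rewrite ?mulgA.
have Est' y : y * s * t * s = y * t * s * t.
  by rewrite -?mulgA; congr (_ * _); rewrite ?mulgA.
by rewrite (Ert' (x * r * s * t * r * s)) -(Ert' (x * r * s)) -(Est' (x * r * s
  * r))
  (Ers' x) (Ert' (x * s * r * s)) (Ers' (x * s * r * s * t))
  (Est' (x * s * r)) (Ert' (x * s)) -(Ert' (x * s * t * r * s)).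
Qed.

Section ArtinMonoid.

Variables (I : finType) (m : I -> I -> nat).

Fixpoint alt (i j : I) (k : nat) : seq I :=
  if k is k'.+1 then i :: alt j i k' else [::].

Lemma size_alt i j k : size (alt i j k) = k.
Proof. by elim: k i j => //= k IHk i j; rewrite IHk. Qed.

Inductive braid_eq : seq I -> seq I -> Prop :=
  | braid_refl u : braid_eq u u
  | braid_sym u v : braid_eq u v -> braid_eq v u
  | braid_trans v u w : braid_eq u v -> braid_eq v w -> braid_eq u w
  | braid_cat u u' v v' :
      braid_eq u u' -> braid_eq v v' -> braid_eq (u ++ v) (u' ++ v')
  | braid_rel i j : i != j -> braid_eq (alt i j (m i j)) (alt j i (m i j)).

Lemma braid_equiv : equiv_class_of (fun u v => `[< braid_eq u v >]).
Proof.
split=> [u|u v|v u w].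
- by apply/asboolP/braid_refl.
- by apply/asboolP/asboolP; apply: braid_sym.
- move=> /asboolP uv /asboolP vw; apply/asboolP; exact: braid_trans uv vw.
Qed.

Canonical braid_equiv_rel := EquivRelPack braid_equiv.

Definition artin_monoid : Type := {eq_quot braid_equiv_rel}.
HB.instance Definition _ := Choice.on artin_monoid.
HB.instance Definition _ := Quotient.on artin_monoid.

Definition mword (u : seq I) : artin_monoid := \pi_artin_monoid u.

Lemma mwordP u v : mword u = mword v <-> braid_eq u v.
Proof.
by split=> [/eqmodP/asboolP | uv]; last by apply/eqmodP/asboolP.
Qed.

Lemma repr_mword u : braid_eq (repr (mword u)) u.
Proof. by apply/mwordP; exact: reprK. Qed.

Lemma mword_ind (P : artin_monoid -> Prop) :
  (forall u, P (mword u)) -> forall x, P x.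
Proof. by move=> Pu x; rewrite -[x]reprK; exact: Pu. Qed.

Definition amon_mul (x y : artin_monoid) := mword (repr x ++ repr y).

Lemma amon_mulE u v : amon_mul (mword u) (mword v) = mword (u ++ v).
Proof. by apply/mwordP/braid_cat; exact: repr_mword. Qed.

Lemma amon_mulA : associative amon_mul.
Proof.
elim/mword_ind=> u; elim/mword_ind=> v; elim/mword_ind=> w.
by rewrite !amon_mulE catA.
Qed.

Lemma amon_mul1g : left_id (mword [::]) amon_mul.
Proof. by elim/mword_ind=> u; rewrite amon_mulE. Qed.

Lemma amon_mulg1 : right_id (mword [::]) amon_mul.
Proof. by elim/mword_ind=> u; rewrite amon_mulE cats0. Qed.

HB.instance Definition _ := isMonoid.Build artin_monoid
  amon_mulA amon_mul1g amon_mulg1.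

Local Notation M := artin_monoid.

Lemma mword_cat u v : mword (u ++ v) = mword u * mword v.
Proof. by rewrite /mul /= amon_mulE. Qed.

Lemma mword_nil : mword [::] = 1. Proof. by []. Qed.

Definition gen i := mword [:: i].

Lemma mword_cons i u : mword (i :: u) = gen i * mword u.
Proof. exact: mword_cat [:: i] u. Qed.

Definition mlen (x : M) := size (repr x).

Lemma braid_eq_size u v : braid_eq u v -> size u = size v.
Proof.
elim=> {u v} [//|//|v u w _ -> _ ->|u u' v v' _ uu' _ vv'|i j _] //.
  by rewrite !size_cat uu' vv'.
by rewrite !size_alt.
Qed.

Lemma mlen_mword u : mlen (mword u) = size u.
Proof. exact: braid_eq_size (repr_mword u). Qed.

Lemma mlenM (x y : M) : mlen (x * y) = (mlen x + mlen y)%N.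
Proof.
elim/mword_ind: x => u; elim/mword_ind: y => v.
by rewrite -mword_cat !mlen_mword size_cat.
Qed.

Lemma mlen_gen i : mlen (gen i) = 1%N.
Proof. exact: mlen_mword. Qed.

Lemma mlen1 : mlen 1 = 0%N.
Proof. exact: mlen_mword. Qed.

Lemma amon_genP (x : M) : x = 1 \/ exists i y, x = gen i * y.
Proof.
elim/mword_ind: x => -[|i u]; [by left|right].
by exists i, (mword u); rewrite mword_cons.
Qed.

Hypothesis m_sym : forall i j, m i j = m j i.
Hypothesis m_diag : forall i, m i i = 1%N.
Hypothesis m_gt1 : forall i j, i != j -> 1 < m i j.

Definition compl i j := mword (alt j i (m i j).-1).

Lemma compl_id i : compl i i = 1.
Proof. by rewrite /compl m_diag. Qed.

Lemma gen_compl i j : gen i * compl i j = mword (alt i j (m i j)).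
Proof.
rewrite /compl -mword_cons; case: (eqVneq i j) => [->|/m_gt1];
  first by rewrite m_diag.
by case: (m i j).
Qed.

Lemma compl_lcm i j : gen i * compl i j = gen j * compl j i.
Proof.
rewrite !gen_compl (m_sym j i); case: (eqVneq i j) => [-> //|neq_ij].
exact/mwordP/braid_rel.
Qed.

Lemma compl_neq1 i j : i != j -> compl i j <> 1.
Proof.
by move=> /m_gt1 gt1 /(congr1 mlen); rewrite mlen1 mlen_mword size_alt; lia.
Qed.

(** The bound on the length makes the reduction lemma available for the tails of the words for which
    it is being proved. *)
Definition reduction_upto n := forall i j (u v : M),
  mlen (gen i * u) <= n -> gen i * u = gen j * v ->
  exists w, u = compl i j * w /\ v = compl j i * w.

(* Dehornoy's cube condition for the letters r, s, t: the lcm of r and s and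
   the lcm of r and t have, locally, a common multiple that is a multiple of
   the lcm of s and t. *)
Definition cube r s t := forall n, reduction_upto n -> forall w1 w2 : M,
  mlen (compl r s * w1) <= n -> compl r s * w1 = compl r t * w2 ->
  exists w, compl s r * w1 = compl s t * w /\ compl t r * w2 = compl t s * w.

Lemma cube_sym r s t : cube r s t -> cube r t s.
Proof.
move=> cube_rst n R w1 w2 len_n E.
by have [|w [E1 E2]] := cube_rst n R w2 w1 _ (esym E);
  [rewrite -E | exists w].
Qed.

(** * The reduction lemma from the cube condition *)

Section Cube.
Hypothesis cubeP : forall r s t, r != s -> r != t -> s != t -> cube r s t.

Lemma cancel_upto n u (w1 w2 : M) : reduction_upto n ->
  mlen (mword u * w1) <= n -> mword u * w1 = mword u * w2 -> w1 = w2.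
Proof.
move=> R; elim: u => [|i u IHu]; first by rewrite mword_nil !mul1g.
rewrite mword_cons -!mulgA => len_n /(R _ _ _ _ len_n)[w].
rewrite compl_id !mul1g => -[<- /esym]; apply: IHu.
by move: len_n; rewrite !mlenM; lia.
Qed.

Lemma cube_all r s t n (w1 w2 : M) : reduction_upto n ->
    mlen (compl r s * w1) <= n -> compl r s * w1 = compl r t * w2 ->
  exists w, compl s r * w1 = compl s t * w /\ compl t r * w2 = compl t s * w.
Proof.
move=> R; case: (eqVneq r s) => [->|rs].
  by rewrite compl_id !mul1g => _ ->; exists w2.
case: (eqVneq r t) => [->|rt].
  by rewrite compl_id !mul1g => _ <-; exists w1.
case: (eqVneq s t) => [->|st]; last exact: cubeP.
move=> len_n E; have {E} -> : w2 = w1.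
  by apply: (cancel_upto R) (esym E); rewrite -E.
by exists (compl t r * w1); rewrite compl_id !mul1g.
Qed.

(** Induction on the derivation of the equality. Only transitivity is hard: the tail of the middle
    word, of length at most [n], is factored in two ways, and the cube condition joins them. *)
Lemma reductionS n : reduction_upto n -> reduction_upto n.+1.
Proof.
move=> R.
suff Q U V : braid_eq U V -> size U <= n.+1 -> forall i u j v,
    U = i :: u -> V = j :: v ->
    exists w, mword u = compl i j * w /\ mword v = compl j i * w.
  move=> i j; elim/mword_ind=> u; elim/mword_ind=> v.
  rewrite -!mword_cons mlen_mword => len_n /mwordP E; exact: Q E _ _ _ _ _ _ _.
elim=> {U V}.
- move=> U _ i u j v -> [-> ->]; exists (mword v).
  by rewrite compl_id mul1g.
- move=> U V UV IH len_n i u j v EV EU; rewrite -(braid_eq_size UV) in len_n.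
  by have [w [Eu Ev]] := IH len_n _ _ _ _ EU EV; exists w.
- move=> W U V UW IHU WV IHV len_n i u j v EU EV.
  have len_W := braid_eq_size UW; case: W => [|r w] in UW IHU WV IHV len_W.
    by rewrite EU in len_W.
  have [w1 [Eu Ew1]] := IHU len_n _ _ _ _ EU erefl.
  rewrite len_W in len_n.
  have [w2 [Ew2 Ev]] := IHV len_n _ _ _ _ erefl EV.
  have [|w3 [E1 E2]] := cube_all R _ (etrans (esym Ew1) Ew2).
    by rewrite -Ew1 mlen_mword.
  by exists w3; rewrite Eu Ev.
- move=> u u' v v' uu' IHu vv' IHv; rewrite size_cat => len_n i U j V.
  have len_u := braid_eq_size uu'.
  (* If the first factor is empty, so is its partner, because relations preserve the length; the
     first letters then lie in the second factors. *)
  case: u => [|i' u] in uu' IHu len_n len_u *.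
    by case: u' => // in uu' IHu len_u * => /= EU EV; apply: IHv EU EV; lia.
  case: u' => // j' u' in uu' IHu len_u * => -[<- <-] [<- <-].
  have [|w [Eu Eu']] := IHu _ _ _ _ _ erefl erefl; first by lia.
  exists (w * mword v); rewrite !mword_cat Eu Eu' !mulgA; split=> //.
  by congr (_ * _); apply/mwordP/braid_sym.
- move=> i j neq_ij _ i' u j' v Eu Ev.
  have := m_gt1 neq_ij; case Em: (m i j) Eu Ev => [|k] //= [<- <-] [<- <-] _.
  by exists 1; rewrite !mulg1 /compl (m_sym j i) Em.
Qed.

Lemma amon_reduction i j (u v : M) : gen i * u = gen j * v ->
  exists w, u = compl i j * w /\ v = compl j i * w.
Proof.
have R n : reduction_upto n.
  elim: n => [|n]; last exact: reductionS.
  by move=> {}i {}j {}u {}v; rewrite mlenM mlen_gen.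
exact: R (leqnn _).
Qed.

End Cube.

(** * The cube condition in diagrams of rank three *)

Lemma compl2 i j : m i j = 2%N -> compl i j = gen j.
Proof. by rewrite /compl => ->. Qed.

Lemma compl3 i j : m i j = 3%N -> compl i j = gen j * gen i.
Proof. by rewrite /compl => -> /=; rewrite mword_cons. Qed.

Lemma compl4 i j : m i j = 4%N -> compl i j = gen j * (gen i * gen j).
Proof. by rewrite /compl => -> /=; rewrite 2!mword_cons. Qed.

Lemma comm2 i j : m i j = 2%N -> gen i * gen j = gen j * gen i.
Proof.
by move=> m2; have := compl_lcm i j; rewrite !compl2 // m_sym.
Qed.

Lemma braid3 i j : m i j = 3%N -> gen i * gen j * gen i = gen j * gen i * gen j.
Proof.
by move=> m3; have := compl_lcm i j; rewrite !compl3 ?mulgA // m_sym.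
Qed.

Lemma braid4 i j : m i j = 4%N ->
  gen i * gen j * gen i * gen j = gen j * gen i * gen j * gen i.
Proof.
by move=> m4; have := compl_lcm i j; rewrite !compl4 ?mulgA // m_sym.
Qed.

Lemma cube_comm_mid r s t : m r s = 2%N -> m r t = 2%N -> cube r s t.
Proof.
move=> rs rt n R w1 w2; rewrite (compl2 rs) (compl2 rt).
rewrite (@compl2 s r) ?(@compl2 t r) 1?m_sym // => len_n.
move=> /(R _ _ _ _ len_n)[w [-> ->]]; exists (gen r * w).
have comm_alt i j k : m r i = 2%N -> m r j = 2%N ->
    gen r * mword (alt i j k) = mword (alt i j k) * gen r.
  elim: k i j => [|k IHk] i j ri rj /=; first by rewrite mword_nil mulg1 mul1g.
  by rewrite mword_cons mulgA (comm2 ri) -!mulgA IHk.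
by rewrite /compl !mulgA !comm_alt.
Qed.

(** Since [t] commutes with the letters of [compl r s], the claim [pass] moves it through this word
    letter by letter, each time by the reduction lemma within the length bound. *)
Lemma cube_comm_end r s t : m r t = 2%N -> m s t = 2%N -> cube r s t.
Proof.
move=> rt st n R w1 w2; have [tr ts] : m t r = 2%N /\ m t s = 2%N.
  by rewrite !(m_sym t).
have comm_alt i j k : m t i = 2%N -> m t j = 2%N ->
    gen t * mword (alt i j k) = mword (alt i j k) * gen t.
  elim: k i j => [|k IHk] i j ti tj /=; first by rewrite mword_nil mulg1 mul1g.
  by rewrite mword_cons mulgA (comm2 ti) -!mulgA IHk.
have pass i j k (x y : M) : m t i = 2%N -> m t j = 2%N ->
    mlen (mword (alt i j k) * x) <= n -> mword (alt i j k) * x = gen t * y ->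
    exists z, x = gen t * z /\ y = mword (alt i j k) * z.
  move=> + + ; elim: k i j x y => [|k IHk] i j x y ti tj /=.
    by rewrite mword_nil !mul1g => _ ->; exists y; rewrite mul1g.
  rewrite mword_cons -mulgA => len_n /(R _ _ _ _ len_n)[z [E ->]].
  have [| | | |z' [-> ->]] := IHk j i x z => //.
  - by move: len_n; rewrite !mlenM; lia.
  - by rewrite E compl2 // m_sym.
  by exists z'; rewrite compl2 // mulgA.
rewrite (compl2 rt) (compl2 tr) (compl2 st) (compl2 ts) => len_n E.
have [| |z [-> ->]] := pass _ _ _ _ _ _ _ len_n E => //.
exists (compl s r * z); rewrite -/(compl r s) !mulgA compl_lcm.
by rewrite {2}/compl comm_alt.
Qed.

(** All equations of the context become equations between lengths, from which the bound required by
    the reduction lemma follows. *)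
Ltac lens :=
  repeat match goal with H : _ = _ |- _ => move/(congr1 mlen): H end;
  match goal with H : is_true (mlen _ <= _) |- _ => move: H end;
  rewrite !mlenM ?mlen_gen; clear; lia.

(* Word reversing: the two words are compared letter by letter, which yields
   the common multiple. *)
Lemma cube_A3_mid r s t :
  m r s = 3%N -> m r t = 3%N -> m s t = 2%N -> cube r s t.
Proof.
move=> rs rt st n R w1 w2.
have [sr [tr ts]] : m s r = m r s /\ m t r = m r t /\ m t s = m s t
  by split; [|split]; exact: m_sym.
rewrite rs rt st in sr tr ts.
have Crs := compl3 rs.
have Csr := compl3 sr.
have Crt := compl3 rt.
have Ctr := compl3 tr.
have Cst := compl2 st.
have Cts := compl2 ts.
have Brs := braid3 rs.
have Brt := braid3 rt.
have Bst := comm2 st.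
rewrite Crs Csr Crt Ctr Cst Cts -!mulgA => Hlen E.
clear rs rt st sr tr ts.
have [|z1 [F1 G1]] := R _ _ _ _ _ E; first by lens.
rewrite ?compl_id ?Cst ?Cts -?mulgA ?mul1g in F1 G1.
have [|z2 [F2 G2]] := R _ _ _ _ _ F1; first by lens.
rewrite ?compl_id ?Crt ?Ctr -?mulgA ?mul1g in F2 G2.
subst w1.
subst z1.
rewrite -?mulgA in G1.
have [|z3 [F3 G3]] := R _ _ _ _ _ G1; first by lens.
rewrite ?compl_id ?Crs ?Csr -?mulgA ?mul1g in F3 G3.
subst w2.
have [|z4 [F4 G4]] := R _ _ _ _ _ G3; first by lens.
rewrite !compl_id !mul1g in F4 G4.
subst z4.
rewrite -?mulgA in G4.
have [|z5 [F5 G5]] := R _ _ _ _ _ G4; first by lens.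
rewrite ?compl_id ?Cst ?Cts -?mulgA ?mul1g in F5 G5.
subst z3.
subst z2.
exists (gen r * gen s * gen t * gen r * z5); rewrite !mulgA; split;
  congr (_ * _).
- by have := cube_A3_mid_eql 1 Brs Brt Bst; rewrite !mul1g.
- by have := cube_A3_mid_eqr 1 Brs Brt Bst; rewrite !mul1g.
Qed.

Lemma cube_A3_end r s t :
  m r s = 3%N -> m r t = 2%N -> m s t = 3%N -> cube r s t.
Proof.
move=> rs rt st n R w1 w2.
have [sr [tr ts]] : m s r = m r s /\ m t r = m r t /\ m t s = m s t
  by split; [|split]; exact: m_sym.
rewrite rs rt st in sr tr ts.
have Crs := compl3 rs.
have Csr := compl3 sr.
have Crt := compl2 rt.
have Ctr := compl2 tr.
have Cst := compl3 st.
have Cts := compl3 ts.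
have Brs := braid3 rs.
have Brt := comm2 rt.
have Bst := braid3 st.
rewrite Crs Csr Crt Ctr Cst Cts -!mulgA => Hlen E.
clear rs rt st sr tr ts.
have [|z1 [F1 G1]] := R _ _ _ _ _ E; first by lens.
rewrite ?compl_id ?Cst ?Cts -?mulgA ?mul1g in F1 G1.
have [|z2 [F2 G2]] := R _ _ _ _ _ F1; first by lens.
rewrite ?compl_id ?Crt ?Ctr -?mulgA ?mul1g in F2 G2.
subst w1.
have [|z3 [F3 G3]] := R _ _ _ _ _ G2; first by lens.
rewrite ?compl_id ?Csr ?Crs -?mulgA ?mul1g in F3 G3.
subst z1.
subst z2.
rewrite -?mulgA in G1.
subst w2.
exists (gen r * gen s * gen t * z3); rewrite !mulgA; split; congr (_ * _).
- by have := cube_A3_end_eql 1 Brs Brt Bst; rewrite !mul1g.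
- by have := cube_A3_end_eqr 1 Brs Brt Bst; rewrite !mul1g.
Qed.

Lemma cube_B3_mid r s t :
  m r s = 3%N -> m r t = 4%N -> m s t = 2%N -> cube r s t.
Proof.
move=> rs rt st n R w1 w2.
have [sr [tr ts]] : m s r = m r s /\ m t r = m r t /\ m t s = m s t
  by split; [|split]; exact: m_sym.
rewrite rs rt st in sr tr ts.
have Crs := compl3 rs.
have Csr := compl3 sr.
have Crt := compl4 rt.
have Ctr := compl4 tr.
have Cst := compl2 st.
have Cts := compl2 ts.
have Brs := braid3 rs.
have Brt := braid4 rt.
have Bst := comm2 st.
rewrite Crs Csr Crt Ctr Cst Cts -!mulgA => Hlen E.
clear rs rt st sr tr ts.
have [|z1 [F1 G1]] := R _ _ _ _ _ E; first by lens.
rewrite ?compl_id ?Cst ?Cts -?mulgA ?mul1g in F1 G1.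
have [|z2 [F2 G2]] := R _ _ _ _ _ F1; first by lens.
rewrite ?compl_id ?Crt ?Ctr -?mulgA ?mul1g in F2 G2.
subst w1.
subst z1.
rewrite -?mulgA in G1.
have [|z3 [F3 G3]] := R _ _ _ _ _ G1; first by lens.
rewrite ?compl_id ?Crs ?Csr -?mulgA ?mul1g in F3 G3.
have [|z4 [F4 G4]] := R _ _ _ _ _ F3; first by lens.
rewrite ?compl_id ?Cts ?Cst -?mulgA ?mul1g in F4 G4.
subst w2.
have [|z5 [F5 G5]] := R _ _ _ _ _ G4; first by lens.
rewrite ?compl_id ?Crt ?Ctr -?mulgA ?mul1g in F5 G5.
subst z3.
subst z4.
rewrite -?mulgA in G3.
have [|z6 [F6 G6]] := R _ _ _ _ _ G3; first by lens.
rewrite !compl_id !mul1g in F6 G6.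
subst z6.
rewrite -?mulgA in G6.
have [|z7 [F7 G7]] := R _ _ _ _ _ G6; first by lens.
rewrite ?compl_id ?Cst ?Cts -?mulgA ?mul1g in F7 G7.
have [|z8 [F8 G8]] := R _ _ _ _ _ F7; first by lens.
rewrite !compl_id !mul1g in F8 G8.
subst z8.
rewrite -?mulgA in G8.
subst z7.
rewrite -?mulgA in G7.
have [|z9 [F9 G9]] := R _ _ _ _ _ G7; first by lens.
rewrite ?compl_id ?Crs ?Csr -?mulgA ?mul1g in F9 G9.
subst z2.
have [|z10 [F10 G10]] := R _ _ _ _ _ G9; first by lens.
rewrite !compl_id !mul1g in F10 G10.
subst z10.
rewrite -?mulgA in G10.
have [|z11 [F11 G11]] := R _ _ _ _ _ G10; first by lens.
rewrite ?compl_id ?Cst ?Cts -?mulgA ?mul1g in F11 G11.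
subst z9.
subst z5.
exists (gen r * gen s * gen t * gen r * gen t * gen s * gen r * z11);
  rewrite !mulgA; split; congr (_ * _).
- by have := cube_B3_mid_eql 1 Brs Brt Bst; rewrite !mul1g.
- by have := cube_B3_mid_eqr 1 Brs Brt Bst; rewrite !mul1g.
Qed.

Lemma cube_B3_end3 r s t :
  m r s = 3%N -> m r t = 2%N -> m s t = 4%N -> cube r s t.
Proof.
move=> rs rt st n R w1 w2.
have [sr [tr ts]] : m s r = m r s /\ m t r = m r t /\ m t s = m s t
  by split; [|split]; exact: m_sym.
rewrite rs rt st in sr tr ts.
have Crs := compl3 rs.
have Csr := compl3 sr.
have Crt := compl2 rt.
have Ctr := compl2 tr.
have Cst := compl4 st.
have Cts := compl4 ts.
have Brs := braid3 rs.
have Brt := comm2 rt.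
have Bst := braid4 st.
rewrite Crs Csr Crt Ctr Cst Cts -!mulgA => Hlen E.
clear rs rt st sr tr ts.
have [|z1 [F1 G1]] := R _ _ _ _ _ E; first by lens.
rewrite ?compl_id ?Cst ?Cts -?mulgA ?mul1g in F1 G1.
have [|z2 [F2 G2]] := R _ _ _ _ _ F1; first by lens.
rewrite ?compl_id ?Crt ?Ctr -?mulgA ?mul1g in F2 G2.
subst w1.
have [|z3 [F3 G3]] := R _ _ _ _ _ G2; first by lens.
rewrite ?compl_id ?Csr ?Crs -?mulgA ?mul1g in F3 G3.
have [|z4 [F4 G4]] := R _ _ _ _ _ F3; first by lens.
rewrite ?compl_id ?Ctr ?Crt -?mulgA ?mul1g in F4 G4.
subst z1.
have [|z5 [F5 G5]] := R _ _ _ _ _ G4; first by lens.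
rewrite ?compl_id ?Cst ?Cts -?mulgA ?mul1g in F5 G5.
subst z3.
subst z4.
rewrite -?mulgA in G3.
subst z2.
rewrite -?mulgA in G1.
subst w2.
exists (gen r * gen s * gen t * gen s * gen r * z5); rewrite !mulgA; split;
  congr (_ * _).
- by have := cube_B3_end3_eql 1 Brs Brt Bst; rewrite !mul1g.
- by have := cube_B3_end3_eqr 1 Brs Brt Bst; rewrite !mul1g.
Qed.

Lemma cube_B3_end4 r s t :
  m r s = 4%N -> m r t = 2%N -> m s t = 3%N -> cube r s t.
Proof.
move=> rs rt st n R w1 w2.
have [sr [tr ts]] : m s r = m r s /\ m t r = m r t /\ m t s = m s t
  by split; [|split]; exact: m_sym.
rewrite rs rt st in sr tr ts.
have Crs := compl4 rs.
have Csr := compl4 sr.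
have Crt := compl2 rt.
have Ctr := compl2 tr.
have Cst := compl3 st.
have Cts := compl3 ts.
have Brs := braid4 rs.
have Brt := comm2 rt.
have Bst := braid3 st.
rewrite Crs Csr Crt Ctr Cst Cts -!mulgA => Hlen E.
clear rs rt st sr tr ts.
have [|z1 [F1 G1]] := R _ _ _ _ _ E; first by lens.
rewrite ?compl_id ?Cst ?Cts -?mulgA ?mul1g in F1 G1.
have [|z2 [F2 G2]] := R _ _ _ _ _ F1; first by lens.
rewrite ?compl_id ?Crt ?Ctr -?mulgA ?mul1g in F2 G2.
have [|z3 [F3 G3]] := R _ _ _ _ _ F2; first by lens.
rewrite ?compl_id ?Cst ?Cts -?mulgA ?mul1g in F3 G3.
subst w1.
subst z2.
rewrite -?mulgA in G2.
have [|z4 [F4 G4]] := R _ _ _ _ _ G2; first by lens.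
rewrite ?compl_id ?Csr ?Crs -?mulgA ?mul1g in F4 G4.
subst z1.
have [|z5 [F5 G5]] := R _ _ _ _ _ G4; first by lens.
rewrite !compl_id !mul1g in F5 G5.
subst z5.
rewrite -?mulgA in G5.
have [|z6 [F6 G6]] := R _ _ _ _ _ G5; first by lens.
rewrite ?compl_id ?Crt ?Ctr -?mulgA ?mul1g in F6 G6.
have [|z7 [F7 G7]] := R _ _ _ _ _ F6; first by lens.
rewrite ?compl_id ?Cst ?Cts -?mulgA ?mul1g in F7 G7.
subst z4.
subst z6.
rewrite -?mulgA in G6.
subst z3.
rewrite -?mulgA in G1.
subst w2.
exists (gen r * gen s * gen r * gen t * gen s * gen r * z7); rewrite !mulgA;
  split; congr (_ * _).
- by have := cube_B3_end4_eql 1 Brs Brt Bst; rewrite !mul1g.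
- by have := cube_B3_end4_eqr 1 Brs Brt Bst; rewrite !mul1g.
Qed.

(** The rank three diagrams, by the labels of [rs], [rt] and [st]. Two labels 2 mean that some
    letter commutes with both others; the list runs through A_3 and B_3 with every placement of the
    letters. *)
Definition cube_labels a b c :=
  [|| (a == 2) && (b == 2), (a == 2) && (c == 2), (b == 2) && (c == 2)
    | (a, b, c) \in [:: (3, 3, 2); (3, 2, 3); (2, 3, 3); (3, 4, 2); (4, 3, 2);
                       (3, 2, 4); (2, 3, 4); (4, 2, 3); (2, 4, 3)]].

Lemma cube_of_labels r s t : cube_labels (m r s) (m r t) (m s t) -> cube r s t.
Proof.
have st : m t s = m s t by exact: m_sym.
case/or4P=> [/andP[/eqP rs /eqP rt]|/andP[/eqP rs /eqP st']|/andP[/eqP rt /eqP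
  st']|].
- exact: cube_comm_mid.
- by apply/cube_sym/cube_comm_end; rewrite // st.
- exact: cube_comm_end.
rewrite !inE => /or4P[| | |/or4P[| | |/or3P[]]] /eqP[rs rt st'].
- exact: cube_A3_mid.
- exact: cube_A3_end.
- by apply/cube_sym/cube_A3_end; rewrite // st.
- exact: cube_B3_mid.
- by apply/cube_sym/cube_B3_mid; rewrite // st.
- exact: cube_B3_end3.
- by apply/cube_sym/cube_B3_end3; rewrite // st.
- exact: cube_B3_end4.
- by apply/cube_sym/cube_B3_end4; rewrite // st.
Qed.

End ArtinMonoid.

(** * The center of an Artin group with a central positive element *)

Section Center.

Variables (r : nat) (lab : nat -> nat -> nat).

Definition label (i j : 'I_r) : nat :=
  if i == j then 1%N else lab (minn i j) (maxn i j).

Hypothesis lab_gt1 : forall i j, i < j < r -> 1 < lab i j.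
Hypothesis lab_cube : forall i j k : 'I_r, i != j -> i != k -> j != k ->
  cube_labels (label i j) (label i k) (label j k).
Hypothesis lab_connected : forall S : 'I_r -> Prop, (exists i, S i) ->
  (forall i j, S i -> 2 < label i j -> S j) -> forall j, S j.

Let M := artin_monoid label.
Let G := artin (@diagram r lab).

Lemma label_sym i j : label i j = label j i.
Proof. by rewrite /label eq_sym minnC maxnC. Qed.

Lemma label_diag i : label i i = 1%N.
Proof. by rewrite /label eqxx. Qed.

Lemma label_gt1 i j : i != j -> 1 < label i j.
Proof.
rewrite /label => neq_ij; rewrite (negPf neq_ij); apply: lab_gt1.
by have := ltn_ord i; have := ltn_ord j; move: neq_ij; rewrite -val_eqE /=; lia.
Qed.

Lemma artin_reduction i j (u v : M) : gen label i * u = gen label j * v ->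
  exists w, u = compl label i j * w /\ v = compl label j i * w.
Proof.
apply: (amon_reduction label_sym label_diag label_gt1) => {}i {}j k ij ik jk.
exact: (cube_of_labels label_sym label_diag label_gt1 (lab_cube ij ik jk)).
Qed.

Lemma artin_gen_inj : injective (gen label).
Proof.
exact: (gen_inj (@mlenM _ label) (@mlen_gen _ label) (@amon_genP _ label)
  (compl_neq1 label_gt1) artin_reduction).
Qed.

Let connected (S : 'I_r -> Prop) : (exists i, S i) ->
  (forall i j, S i ->
     (exists x, compl label j i = gen label i * gen label j * x) -> S j) ->
  forall j, S j.
Proof.
move=> exS adjS; apply: lab_connected exS _ => i j Si gt2; apply: adjS Si _.
rewrite /compl (label_sym j i); case: (label i j) gt2 => [|[|[|k]]] // _.
by exists (mword label (alt i j k)); rewrite !mword_cons mulgA.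
Qed.

Lemma amon_mulI (x u v : M) : x * u = x * v -> u = v.
Proof.
exact: (monoid_mulI (@mlenM _ label) (@mlen_gen _ label) (@amon_genP _ label)
  (compl_id label_diag) artin_reduction).
Qed.

Lemma amon_central_divides (p : M) i : quasi_central (gen label) p -> p <> 1 ->
  divides (gen label i) p.
Proof.
exact: (quasi_central_divides (@amon_genP _ label)
  (compl_id label_diag) artin_reduction connected).
Qed.

Definition pos (u : seq 'I_r) : word 'I_r := [seq (i, false) | i <- u].

Lemma alternatingE i j k : alternating i j k = pos (alt i j k).
Proof. by elim: k i j => //= k IHk i j; rewrite IHk. Qed.

Definition gword (u : seq 'I_r) : G := pres_class _ (pos u).

Lemma gclass_cat u v :
  pres_class (artin_relations (@diagram r lab)) (u ++ v)
  = pres_class _ u * pres_class _ v.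
Proof. by symmetry; exact: pres_mulE. Qed.

Lemma gword_cat u v : gword (u ++ v) = gword u * gword v.
Proof. by rewrite /gword /pos map_cat gclass_cat. Qed.

Lemma braid_eq_pres u v : braid_eq label u v ->
  pres_eq (artin_relations (@diagram r lab)) (pos u) (pos v).
Proof.
elim=> {u v} [u|u v _|v u w _ uv _|u u' v v' _ uu' _ vv'|i j neq_ij].
- exact: pres_refl.
- exact: pres_sym.
- exact: pres_trans uv.
- by rewrite /pos !map_cat; apply: pres_cat.
apply: pres_rel; exists i, j, (label i j).
by rewrite !alternatingE.
Qed.

Definition iota (x : M) : G := gword (repr x).

Lemma iota_mword u : iota (mword label u) = gword u.
Proof. by apply/pres_classP/braid_eq_pres/repr_mword. Qed.

Lemma iotaM (x y : M) : iota (x * y) = iota x * iota y.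
Proof.
elim/mword_ind: x => u; elim/mword_ind: y => v.
by rewrite -mword_cat !iota_mword gword_cat.
Qed.

Lemma iota1 : iota 1 = 1. Proof. exact: (iota_mword [::]). Qed.

Lemma iotaX (x : M) n : iota (x ^+ n) = iota x ^+ n.
Proof. by elim: n => [|n IHn]; rewrite ?iota1 // !expgS iotaM IHn. Qed.

Variable zeta : M.
Hypothesis zetaC : mcentral zeta.
Hypothesis zeta1 : zeta <> 1.

Let zeta_gen : exists f : 'I_r -> M, forall i, zeta = gen label i * f i.
Proof.
have zeta_div i : exists y : M, zeta = gen label i * y.
  by apply: amon_central_divides zeta1; exact: central_quasi_central.
by have [f fE] := choice zeta_div; exists f.
Qed.

Lemma gclass_inv i : pres_class (artin_relations (@diagram r lab)) [:: (i,
  true)]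
  = (iota (gen label i))^-1.
Proof.
by rewrite iota_mword; symmetry; exact: pres_invE.
Qed.

Lemma mcentral_iota (p : M) : mcentral p -> forall x : G, commute (iota p) x.
Proof.
move=> pC; elim/pres_ind => u; elim: u => [|[i b] u IHu].
  exact: (commute1 (iota p)).
rewrite -cat1s gclass_cat; apply: commuteM => //.
have pi : commute (iota p) (iota (gen label i)) by rewrite /commute -!iotaM pC.
case: b; last by rewrite -[X in commute _ X]/(gword [:: i]) -iota_mword.
by rewrite gclass_inv; exact: commuteV.
Qed.

Section Embedding.

Variable f : 'I_r -> M.
Hypothesis fE : forall i, zeta = gen label i * f i.

Let fE' i : zeta = f i * gen label i.
Proof. by apply: (@amon_mulI (gen label i)); rewrite mulgA -fE zetaC. Qed.

(* A word in the letters and their inverses is sent to the fraction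
   [numerator w / zeta ^+ nneg w]. *)
Definition nneg (w : word 'I_r) := count snd w.

Fixpoint numerator (w : word 'I_r) : M :=
  if w is a :: w' then (if a.2 then f a.1 else gen label a.1) * numerator w'
  else 1.

Lemma numerator_cat u v : numerator (u ++ v) = numerator u * numerator v.
Proof. by elim: u => [|a u IHu] /=; rewrite ?mul1g // IHu mulgA. Qed.

Lemma nneg_cat u v : nneg (u ++ v) = (nneg u + nneg v)%N.
Proof. exact: count_cat. Qed.

Lemma numerator_pos u : numerator (pos u) = mword label u.
Proof. by elim: u => //= i u ->; rewrite mword_cons. Qed.

Lemma nneg_pos u : nneg (pos u) = 0%N.
Proof. by elim: u. Qed.

Let zetaXC n (x : M) : commute (zeta ^+ n) x.
Proof. by apply/commute_sym/commuteX/commute_sym/zetaC. Qed.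

(** The fraction attached to a word depends only on its class. Fractions are compared by
    cross-multiplication inside the monoid, where powers of [zeta] are central and can be
    cancelled. *)
Lemma pres_eq_numerator u v :
    pres_eq (artin_relations (@diagram r lab)) u v ->
  numerator u * zeta ^+ nneg v = numerator v * zeta ^+ nneg u.
Proof.
elim=> {u v} [u|u v _ ->|v u w _ uv _ vw|u u' v v' _ uu' _ vv'|[i b]|u v] //.
- apply: (@amon_mulI (zeta ^+ nneg v)); rewrite !mulgA.
  rewrite !(zetaXC (nneg v) (numerator _)) uv -mulgA (zetaXC (nneg u)) mulgA.
  by rewrite vw.
- rewrite !numerator_cat !nneg_cat !expgnDr -!mulgA.
  rewrite (mulgA (numerator v)) -(zetaXC (nneg u')) -mulgA vv'.
  rewrite (mulgA (numerator v')) -(zetaXC (nneg u)) -!mulgA.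
  by rewrite (mulgA (numerator u)) uu' -!mulgA.
- by rewrite /nneg; case: b => /=; rewrite !mulg1 !mul1g -?fE -?fE' expg1.
case=> i [j [m [neq_ij [] <- [-> ->]]]]; rewrite !alternatingE.
rewrite !numerator_pos !nneg_pos !mulg1; apply/mwordP.
by have := braid_rel label neq_ij; rewrite -/(label j i) /label (negPf neq_ij).
Qed.

Lemma class_numerator u :
  pres_class _ u * iota zeta ^+ nneg u = iota (numerator u).
Proof.
elim: u => [|[i b] u IHu]; first by rewrite mulg1 iota1.
rewrite -cat1s gclass_cat numerator_cat iotaM nneg_cat -IHu expgnDr -!mulgA.
case: b => /=; rewrite ?mul1g mulg1 ?expg1; last first.
  by rewrite [iota (gen _ _)]iota_mword.
rewrite (mulgA (pres_class _ u)) -(mcentral_iota zetaC (pres_class _ u)) !mulgA.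
by rewrite gclass_inv (fE i) iotaM mulKg.
Qed.

End Embedding.

Lemma gcentral_numerator (x : G) : (forall y, commute x y) ->
  exists (p : M) e, mcentral p /\ x * iota zeta ^+ e = iota p.
Proof.
have [f fE] := zeta_gen.
elim/pres_ind: x => u uC; exists (numerator f u), (nneg u).
split; last exact: class_numerator.
(* The words [i u] and [u i] have the same class and equally many inverse letters, so the equality
   of fractions reduces to one of numerators. *)
have gen_comm i : commute (numerator f u) (gen label i).
  have /pres_classP/(pres_eq_numerator fE) :
      pres_class (artin_relations (@diagram r lab)) ((i, false) :: u) =
      pres_class _ (u ++ [:: (i, false)]).
    by rewrite -cat1s !gclass_cat -uC.
  have -> : nneg (u ++ [:: (i, false)]) = nneg u by rewrite nneg_cat addn0.
  rewrite numerator_cat [nneg _]add0n /= mulg1 => E.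
  apply: (@amon_mulI (zeta ^+ nneg u)); apply: esym.
  have zX (y : M) : commute (zeta ^+ nneg u) y.
    exact/commute_sym/commuteX/commute_sym/zetaC.
  by rewrite !zX.
elim/mword_ind => v; elim: v => [|i v IHv]; first exact: commute1.
by rewrite mword_cons; apply: commuteM.
Qed.

(** As [D] need not be central, the invariants of central elements do not apply to it. From
    [p = D ^+ a] and [zeta = D ^+ b] only the relation p^b = zeta^a between central elements is
    retained. *)
Lemma mcentral_powers :
    (forall (x : G) a b, (forall y, commute x y) -> 0 < b ->
       x ^+ b = iota zeta ^+ a -> b %| a) ->
  forall p : M, mcentral p -> exists c, p = zeta ^+ c.
Proof.
move=> dvd p pC.
have [D [a [b [Ep Ez]]]] := central_common_root (@mlenM _ label)
  (@mlen_gen _ label) (@amon_genP _ label) (compl_id label_diag)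
  (compl_neq1 label_gt1) (compl_lcm label_sym label_diag label_gt1)
  artin_reduction connected pC zetaC.
have b_gt0 : 0 < b by case: b Ez => // /zeta1.
have /dvdnP[c Ea] : b %| a.
  apply: (dvd (iota p)) => //; first exact: mcentral_iota.
  by rewrite Ep Ez !iotaX -!expgnA mulnC.
by exists c; rewrite Ep Ez Ea mulnC expgnA.
Qed.

Lemma central_divisor_basis : exists D, [/\ D <> 1,
  central_divisor (gen label) D &
  forall p, central_divisor (gen label) p -> exists n, p = D ^+ n].
Proof.
exact: (central_divisor_powers (@mlenM _ label) (@mlen_gen _ label)
  (@amon_genP _ label) (compl_id label_diag) (compl_neq1 label_gt1)
  (compl_lcm label_sym label_diag label_gt1) artin_reduction connected zetaC
    zeta1).
Qed.

Lemma gcentral_root k (y : G) : iota zeta = y ^+ k ->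
    (forall p : M, mcentral p -> exists c, p = zeta ^+ c) ->
  forall x : G, (forall y, commute x y) -> exists y, x = y ^+ k.
Proof.
move=> Ez powers x /gcentral_numerator[p [e [/powers[c ->] Ex]]].
have -> : x = iota (zeta ^+ c) * (iota zeta ^+ e)^-1 by rewrite -Ex mulgK.
exists (y ^+ c * (y ^+ e)^-1).
rewrite iotaX Ez expgMn; last by apply/commuteV/commuteX/commute_sym/commuteX.
by rewrite expVgn -!expgnA ![(k * _)%N]mulnC.
Qed.

End Center.

(** * Powers of a Coxeter element *)

Section CoxeterElement.

(** A path of letters followed by a tail [T]: 1 in type A, the last letter in type B, the product of
    the two leaves in type D. The relation [T_braid] of length four covers the three cases at
    once. *)
Variables (M : monoidType) (x : nat -> M) (k : nat) (T : M).
Hypothesis x_comm : forall i j, i.+1 < j < k -> commute (x i) (x j).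
Hypothesis x_braid : forall i, i.+1 < k ->
  x i * x i.+1 * x i = x i.+1 * x i * x i.+1.
Hypothesis T_comm : forall i, i.+1 < k -> commute T (x i).
Hypothesis T_braid : 0 < k ->
  x k.-1 * T * x k.-1 * T = T * x k.-1 * T * x k.-1.

Definition run i j := \prod_(i <= l < j) x l.
Definition cox := run 0 k * T.
Local Notation c := cox.

Lemma commute_run (y : M) i j : (forall l, i <= l < j -> commute y (x l)) ->
  commute y (run i j).
Proof.
move=> yC; rewrite /run big_nat; apply: (big_ind (commute y)) => //.
- exact: commute1.
- by move=> u v; exact: commuteM.
Qed.

Lemma run_shift i : i.+1 < k -> run 0 k * x i = x i.+1 * run 0 k.
Proof.
move=> lt_ik; have -> : run 0 k = run 0 i * (x i * x i.+1) * run i.+2 k.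
  rewrite /run (big_cat_nat (n := i)) //=; last by lia.
  rewrite (@big_cat_nat _ _ _ i.+2 i k) //=; last by lia.
  by rewrite (@big_ltn _ _ _ i i.+2) // big_nat1 !mulgA.
have C1 : commute (x i) (run i.+2 k) by apply: commute_run => l ?;
  apply: x_comm; lia.
have C2 : commute (x i.+1) (run 0 i).
  by apply: commute_run => l ?; apply/commute_sym/x_comm; lia.
rewrite -mulgA -C1 !mulgA -(mulgA (run 0 i)) -(mulgA (run 0 i)) x_braid //.
by rewrite !mulgA C2.
Qed.

Lemma cox_shift i : i.+1 < k -> c * x i = x i.+1 * c.
Proof. by move=> lt_ik; rewrite -mulgA T_comm // !mulgA run_shift. Qed.

Lemma cox_shift_run i j : i <= j < k -> c * run i j = run i.+1 j.+1 * c.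
Proof.
elim: j => [|j IHj] lt_jk; first by rewrite /run !big_geq ?mulg1 ?mul1g //; lia.
have [eq_ij|lt_ij] := eqVneq i j.+1.
  by rewrite /run !big_geq ?mulg1 ?mul1g //; lia.
rewrite /run (@big_nat_recr _ _ _ j i) ?(@big_nat_recr _ _ _ j.+1 i.+1) /=;
  [|lia..].
rewrite mulgA [c * _]IHj; last by lia.
by rewrite -(mulgA _ c) cox_shift ?mulgA //; lia.
Qed.

Lemma run_split : 0 < k -> run 0 k = run 0 k.-1 * x k.-1.
Proof. by move=> k_gt0; rewrite -{1}(prednK k_gt0) /run big_nat_recr. Qed.

Lemma run_splitl : 0 < k -> run 0 k = x 0 * run 1 k.
Proof. by move=> k_gt0; rewrite /run big_ltn. Qed.

Let T_run : commute T (run 0 k.-1).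
Proof. by apply: commute_run => l ?; apply: T_comm; lia. Qed.

Lemma run_square : 0 < k -> run 0 k * run 0 k = x 0 * run 0 k * run 0 k.-1.
Proof.
move=> k_gt0; rewrite {1}run_splitl // -!mulgA; congr (_ * _).
suff run_shift_run j : j < k -> run 0 k * run 0 j = run 1 j.+1 * run 0 k.
  by rewrite run_shift_run ?prednK // ltn_predL.
elim: j => [|j IHj] lt_jk.
  by rewrite {2}/run big_geq // mulg1 /run (@big_geq _ _ _ 1) // mul1g.
have -> : run 0 j.+1 = run 0 j * x j by rewrite /run big_nat_recr.
have -> : run 1 j.+2 = run 1 j.+1 * x j.+1 by rewrite /run big_nat_recr.
by rewrite mulgA IHj ?(ltnW lt_jk) // -!mulgA run_shift.
Qed.

(** Conjugation by [c] takes each letter of the path to the next one, and conjugation by c^2 takes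
    the last back to the first, as if one further letter closed the path to a cycle of length
    [k + 1]. *)
Lemma cox_square_last : 0 < k -> c ^+ 2 * x k.-1 = x 0 * c ^+ 2.
Proof.
move=> k_gt0; rewrite expg2; set a := x k.-1; set e := run 0 k.-1.
have gE : run 0 k = e * a by exact: run_split.
have ccE : c * c = run 0 k * e * T * a * T.
  by rewrite /cox {2}gE !mulgA -(mulgA (run 0 k) T e) T_run !mulgA.
rewrite ccE; have -> : run 0 k * e * T * a * T * a = run 0 k * e * (T * a * T *
  a).
  by rewrite !mulgA.
by rewrite -T_braid // !mulgA -(mulgA _ e a) -gE run_square // !mulgA.
Qed.

Lemma cox_pow_shift i j : i + j < k -> c ^+ j * x i = x (i + j)%N * c ^+ j.
Proof.
elim: j => [|j IHj] lt_k; first by rewrite mulg1 mul1g addn0.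
rewrite !expgS -mulgA IHj; last by lia.
by rewrite mulgA addnS cox_shift -?mulgA //; lia.
Qed.

Lemma cox_pow_comm i : i < k -> commute (c ^+ k.+1) (x i).
Proof.
have conj3 (u v w y y' y0 : M) : w * y = y' * w -> v * y' = y0 * v ->
    u * y0 = y * u -> u * (v * w) * y = y * (u * (v * w)).
  by move=> wy vy uy; rewrite -!mulgA wy (mulgA v) vy !mulgA uy.
(* Shifts lead from [x i] to [x k.-1], the square of [c] to [x 0], and shifts again back to
   [x i]. *)
move=> lt_ik; have -> : k.+1 = (i + (2 + (k.-1 - i)))%N by lia.
rewrite /commute !expgnDr; apply: (conj3 _ _ _ _ (x k.-1) (x 0)).
- by rewrite cox_pow_shift; [congr (x _ * _)|]; lia.
- by apply: cox_square_last; lia.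
- exact: cox_pow_shift.
Qed.

Hypothesis mulI : forall u v w : M, u * v = u * w -> v = w.

(** c^(k+1) commutes with the run and with [c], which is the run times [T]; cancelling the run
    leaves [T]. *)
Lemma cox_pow_comm_tail : commute (c ^+ k.+1) T.
Proof.
have gC : commute (c ^+ k.+1) (run 0 k).
  by apply: commute_run => i ?; apply: cox_pow_comm.
apply: (@mulI (run 0 k)).
transitivity (c ^+ k.+1 * c); first by rewrite mulgA -gC -mulgA.
by rewrite -expgSr expgS mulgA.
Qed.

Section Fork.
Variables p q : M.
Hypothesis TE : T = p * q.
Hypothesis pq_comm : commute p q.
Hypothesis k_gt0 : 0 < k.
Hypothesis p_braid : x k.-1 * p * x k.-1 = p * x k.-1 * p.
Hypothesis q_braid : x k.-1 * q * x k.-1 = q * x k.-1 * q.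
Hypothesis p_comm : forall i, i.+1 < k -> commute p (x i).
Hypothesis q_comm : forall i, i.+1 < k -> commute q (x i).

Lemma cox_fork_last : c * x k.-1 * p = q * c * x k.-1.
Proof.
set a := x k.-1; set e := run 0 k.-1.
have eq_comm : commute q e by apply: commute_run => l ?; apply: q_comm; lia.
rewrite /cox run_split // -/a -/e TE !mulgA eq_comm -!mulgA; congr (_ * _).
have pqx (y : M) : p * (q * y) = q * (p * y) by rewrite !mulgA pq_comm.
have pap : p * (a * p) = a * (p * a) by rewrite !mulgA p_braid.
have aqa (y : M) : a * (q * (a * y)) = q * (a * (q * y)).
  by rewrite !mulgA q_braid.
by rewrite !pqx pap aqa.
Qed.

End Fork.

(* Conjugation by c exchanges the two leaves p and q, up to conjugation by a
   final part [run j k] of the path: c^(j+1) = run j k * K, and p can be moved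
   through K. *)
Lemma cox_fork_pow p q : T = p * q -> commute p q -> 0 < k ->
    x k.-1 * p * x k.-1 = p * x k.-1 * p ->
    x k.-1 * q * x k.-1 = q * x k.-1 * q ->
    (forall i, i.+1 < k -> commute p (x i)) ->
    (forall i, i.+1 < k -> commute q (x i)) ->
  c ^+ k.+1 * p = (if odd k then q else p) * c ^+ k.+1.
Proof.
move=> TE pq_comm k_gt0 p_braid q_braid p_comm q_comm.
have last_p : c * x k.-1 * p = q * c * x k.-1 by exact: cox_fork_last.
have last_q : c * x k.-1 * q = p * c * x k.-1.
  by apply: cox_fork_last => //; rewrite TE.
suff main j : j <= k -> exists K, [/\ c ^+ j.+1 = run j k * K,
    c ^+ j.+1 * p = run j k * (if odd j then q else p) * K &
    c ^+ j.+1 * q = run j k * (if odd j then p else q) * K].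
  have [K []] := main k (leqnn k).
  by rewrite /run big_geq // !mul1g => -> -> _.
elim: j => [_|j IHj lt_jk].
  exists (p * q); rewrite expg1 /cox TE /= -!mulgA; split=> //.
  by rewrite pq_comm.
  by rewrite (mulgA q) -pq_comm -mulgA.
have {IHj}[|K [E1 E2 E3]] := IHj; first exact: ltnW.
exists (c * x k.-1 * K); rewrite (expgS c j.+1) -!(mulgA c (c ^+ j.+1)) E2 E3
  E1.
have runE : c * run j k = run j.+1 k * (c * x k.-1).
  have -> : run j k = run j k.-1 * x k.-1.
    by rewrite -{1}(prednK k_gt0) /run big_nat_recr //; lia.
  by rewrite mulgA cox_shift_run ?prednK ?mulgA //; lia.
by rewrite !mulgA runE /=; split; case: (odd j) => /=;
  rewrite -!(mulgA (run j.+1 k)) ?last_p ?last_q // !mulgA.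
Qed.

End CoxeterElement.

(** * Weighted actions *)

Section WeightedAction.

Variables (r : nat) (lab : nat -> nat -> nat) (P : Type).
Variables (s s' : nat -> P -> P) (w : nat -> P -> int).
Hypothesis sK : forall i, i < r -> cancel (s i) (s' i).
Hypothesis s'K : forall i, i < r -> cancel (s' i) (s i).

Fixpoint word_act (u : word 'I_r) (p : P) : P :=
  if u is a :: u' then
    let q := word_act u' p in if a.2 then s' a.1 q else s a.1 q
  else p.

(** A cocycle: an inverse letter subtracts the weight of the letter at the point where it arrives,
    so that a letter and its inverse cancel. *)
Fixpoint word_weight (u : word 'I_r) (p : P) : int :=
  if u is a :: u' then
    let q := word_act u' p in
    (word_weight u' p + if a.2 then - w a.1 (s' a.1 q) else w a.1 q)%R
  else 0%R.

Hypothesis rel_ok : forall i j : 'I_r, i < j -> forall p,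
  word_act (alternating i j (lab i j)) p = word_act (alternating j i (lab i j))
    p
  /\ word_weight (alternating i j (lab i j)) p
     = word_weight (alternating j i (lab i j)) p.

Lemma word_act_cat u v p : word_act (u ++ v) p = word_act u (word_act v p).
Proof. by elim: u => //= a u ->. Qed.

Lemma word_weight_cat u v p :
  word_weight (u ++ v) p = (word_weight v p + word_weight u (word_act v p))%R.
Proof.
elim: u => /= [|a u ->]; first by rewrite GRing.addr0.
by rewrite word_act_cat GRing.addrA.
Qed.

Lemma word_act_eq u v : pres_eq (artin_relations (@diagram r lab)) u v ->
  forall p, word_act u p = word_act v p /\ word_weight u p = word_weight v p.
Proof.
elim=> {u v} [//|u v _ IH p|v u v' _ IH1 _ IH2 p|u u' v v' _ IHu _ IHv p|a p|u
  v].
- by have [-> ->] := IH p.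
- by have [-> ->] := IH1 p; apply: IH2.
- rewrite !word_act_cat !word_weight_cat; have [-> ->] := IHv p.
  by have [-> ->] := IHu (word_act v' p).
- case: a => i [] /=; rewrite ?sK ?s'K ?ltn_ord //; split=> //; lia.
case=> i [j [m [neq_ij [] <- [-> ->]]]] p; rewrite (negPf neq_ij).
have [lt_ij|lt_ji|/val_inj eq_ij] := ltngtP i j.
- exact: rel_ok.
- by have [-> ->] := rel_ok lt_ji p.
- by rewrite eq_ij eqxx in neq_ij.
Qed.

Local Notation G := (artin (@diagram r lab)).

Definition gact (x : G) := word_act (repr x).
Definition gweight (x : G) := word_weight (repr x).

Lemma gact_class u p : gact (pres_class _ u) p = word_act u p.
Proof. by case: (word_act_eq (repr_class (artin_relations (@diagram r lab)) u)
  p). Qed.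

Lemma gweight_class u p : gweight (pres_class _ u) p = word_weight u p.
Proof. by case: (word_act_eq (repr_class (artin_relations (@diagram r lab)) u)
  p). Qed.

Lemma gact1 p : gact 1 p = p. Proof. exact: (gact_class [::]). Qed.

Lemma gweight1 p : gweight 1 p = 0%R. Proof. exact: (gweight_class [::]). Qed.

Lemma gactM x y p : gact (x * y) p = gact x (gact y p).
Proof.
elim/pres_ind: x => u; elim/pres_ind: y => v.
by rewrite -gclass_cat !gact_class word_act_cat.
Qed.

Lemma gweightM x y p :
  gweight (x * y) p = (gweight y p + gweight x (gact y p))%R.
Proof.
elim/pres_ind: x => u; elim/pres_ind: y => v.
by rewrite -gclass_cat !gact_class !gweight_class word_weight_cat.
Qed.

Lemma gactX x n p : gact (x ^+ n) p = iter n (gact x) p.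
Proof. by elim: n => [|n IHn]; rewrite ?gact1 // expgS gactM IHn. Qed.

Lemma gweightX x n p : (forall k, gweight x (iter k (gact x) p) = gweight x p)
  ->
  gweight (x ^+ n) p = (gweight x p * n)%R.
Proof.
move=> wx; elim: n => [|n IHn]; first by rewrite gweight1; lia.
by rewrite expgS gweightM gactX wx IHn; lia.
Qed.

Lemma gweightX_fix x n p : gact x p = p -> gweight (x ^+ n) p = (gweight x p *
  n)%R.
Proof. by move=> xp; apply: gweightX => k; rewrite iter_fix. Qed.

End WeightedAction.

(** * Crossing numbers *)

Section PairAction.

Variables (r : nat) (lab : nat -> nat -> nat) (Q : eqType) (t : nat -> Q -> Q).
Hypothesis tK : forall i, i < r -> involutive (t i).

Definition pair_act i (p : Q * Q) := (t i p.1, t i p.2).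
(** A letter counts when it exchanges the two points. For [swap] the total is the signed number of
    crossings of two strands of a braid, twice their linking number if the braid is pure. *)
Definition pair_weight i (p : Q * Q) : int := (t i p.1 == p.2 : nat).

Hypothesis rel_ok : forall i j : 'I_r, i < j -> forall p,
  word_act pair_act pair_act (alternating i j (lab i j)) p
    = word_act pair_act pair_act (alternating j i (lab i j)) p
  /\ word_weight pair_act pair_act pair_weight (alternating i j (lab i j)) p
    = word_weight pair_act pair_act pair_weight (alternating j i (lab i j)) p.

Local Notation G := (artin (@diagram r lab)).

Definition word_point (u : word 'I_r) (a : Q) : Q :=
  foldr (fun l : 'I_r * bool => t l.1) a u.

Definition gpoint (x : G) : Q -> Q := word_point (repr x).

Definition crossings (x : G) (a b : Q) : int :=
  gweight pair_act pair_act pair_weight x (a, b).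

Lemma word_act_pair u a b : word_act pair_act pair_act u (a, b) =
  (word_point u a, word_point u b).
Proof. by elim: u => //= -[i e] u -> /=; case: e. Qed.

Lemma pairK i : i < r -> cancel (pair_act i) (pair_act i).
Proof. by move=> lt_ir [a b]; rewrite /pair_act /= !tK. Qed.

Lemma gact_pair (x : G) a b :
  gact pair_act pair_act x (a, b) = (gpoint x a, gpoint x b).
Proof. exact: word_act_pair. Qed.

Lemma gpoint_class u a :
  gpoint (pres_class _ u) a = word_point u a.
Proof.
have := gact_class (w := pair_weight) pairK pairK rel_ok u (a, a).
by rewrite gact_pair word_act_pair => -[->].
Qed.

Lemma gpointM (x y : G) a : gpoint (x * y) a = gpoint x (gpoint y a).
Proof.
have := gactM (w := pair_weight) pairK pairK rel_ok x y (a, a).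
by rewrite !gact_pair => -[->].
Qed.

Lemma gpoint1 a : gpoint 1 a = a.
Proof. exact: (gpoint_class [::]). Qed.

Lemma gpointX (x : G) n a : gpoint (x ^+ n) a = iter n (gpoint x) a.
Proof. by elim: n => [|n IHn]; rewrite ?gpoint1 // expgS gpointM IHn. Qed.

Lemma gpoint_gen (i : 'I_r) a : gpoint (gword lab [:: i]) a = t i a.
Proof. exact: gpoint_class. Qed.

Lemma gpoint_inj (x : G) : injective (gpoint x).
Proof.
move=> a b /(congr1 (gpoint x^-1)).
by rewrite -!gpointM mulVg !gpoint1.
Qed.

Lemma crossingsM (x y : G) a b : crossings (x * y) a b
  = (crossings y a b + crossings x (gpoint y a) (gpoint y b))%R.
Proof. by rewrite /crossings (gweightM pairK pairK rel_ok) gact_pair. Qed.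

Lemma crossings_gen (i : 'I_r) a b :
  crossings (gword lab [:: i]) a b = (t i a == b).
Proof. by rewrite /crossings (gweight_class pairK pairK rel_ok) /= GRing.add0r.
  Qed.

Lemma crossingsX (x : G) n a b :
  (forall k, crossings x (iter k (gpoint x) a) (iter k (gpoint x) b)
             = crossings x a b) ->
  crossings (x ^+ n) a b = (crossings x a b * n)%R.
Proof.
move=> wx; apply: (gweightX pairK pairK rel_ok) => k.
rewrite -[RHS]/(crossings x a b) -(wx k); congr (gweight _ _ _ _ _).
by elim: k => //= k ->; rewrite gact_pair.
Qed.

Lemma word_weight_pair_cons (i : 'I_r) e u a b :
  word_weight pair_act pair_act pair_weight ((i, e) :: u) (a, b) =
  (word_weight pair_act pair_act pair_weight u (a, b) +
  (-1) ^+ e * (t i (word_point u a) ==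
               word_point u b : nat)%:Z)%R.
Proof.
rewrite /= word_act_pair; case: e => /=; rewrite /pair_weight /=; last first.
  by rewrite GRing.mul1r.
by rewrite GRing.mulN1r !tK // (inv_eq (tK (ltn_ord i))).
Qed.

Lemma crossings_sym (x : G) a b : crossings x b a = crossings x a b.
Proof.
elim/pres_ind: x => u; rewrite /crossings !(gweight_class pairK pairK rel_ok).
elim: u => [//|[i e] u IHu]; rewrite !word_weight_pair_cons IHu.
by rewrite (inv_eq (tK (ltn_ord i))) eq_sym.
Qed.

Lemma crossings_morph (nu : Q -> Q) : injective nu ->
    (forall (i : 'I_r) a, t i (nu a) = nu (t i a)) ->
  forall x : G, (forall a, gpoint x (nu a) = nu (gpoint x a)) /\
    forall a b, crossings x (nu a) (nu b) = crossings x a b.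
Proof.
move=> nu_inj tnu x.
have ptnu u a : word_point u (nu a) =
    nu (word_point u a).
  by elim: u => //= l u ->; rewrite tnu.
split=> [a|a b]; first exact: ptnu.
elim/pres_ind: x => u; rewrite /crossings !(gweight_class pairK pairK rel_ok).
elim: u => [//|[i e] u IHu]; rewrite !word_weight_pair_cons IHu.
by rewrite !ptnu tnu (inj_eq nu_inj).
Qed.

(* [lt] is an order of the points for which a letter inverts exactly the pair
   that it exchanges, so that the crossing number of a pair has the parity
   prescribed by the induced permutation. *)
Variables good lt : rel Q.
Hypothesis t_good : forall (i : 'I_r) a b, good a b -> good (t i a) (t i b).
Hypothesis t_lt : forall (i : 'I_r) a b, good a b ->
  (t i a == b) = (lt (t i a) (t i b) != lt a b).

Lemma crossings_parity (x : G) a b : good a b -> exists e : int,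
  crossings x a b = (e * 2 + (lt (gpoint x a) (gpoint x b) != lt a b : nat))%R.
Proof.
elim/pres_ind: x => u; rewrite /crossings !(gweight_class pairK pairK rel_ok).
rewrite !gpoint_class => ab.
suff [] : good (word_point u a) (word_point u b)
  /\ exists e : int, word_weight pair_act pair_act pair_weight u (a, b) =
  (e * 2 + (lt (word_point u a)
    (word_point u b) != lt a b : nat))%R by [].
elim: u => [|[i e] u [good_u [c IHu]]].
  by split=> //; exists 0%R; rewrite eqxx.
split; first exact: t_good.
rewrite word_weight_pair_cons IHu (t_lt i good_u) /=.
move: (lt (t i _) _) (lt (word_point _ _) _) => A B.
case: e; case: A; case: B; case: (lt a b) => /=;
  by [exists c; lia | exists (c + 1)%R; lia | exists (c - 1)%R; lia].
Qed.

Lemma root_bound (x z : G) K L a b : x ^+ K = z -> good a b -> 0 < L ->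
    gpoint z a = a -> gpoint z b = b -> crossings z a b = 2%R ->
    iter L (gpoint x) a = a -> iter L (gpoint x) b = b ->
  K <= L.
Proof.
move=> Ez ab L_gt0 za zb z2 xa xb.
have Xa k y c : gpoint y c = c -> iter k (gpoint y) c = c by exact: iter_fix.
have [ya yb] : gpoint (x ^+ L) a = a /\ gpoint (x ^+ L) b = b by rewrite
  !gpointX.
have := crossings_parity (x ^+ L) ab; rewrite ya yb eqxx => -[e Ee].
(* Both sides come from x^(K L). The first is 2 L; the second is 2 e K, as x^L fixes [a] and [b] and
   so has an even number 2 e of crossings. *)
have : crossings (z ^+ L) a b = crossings ((x ^+ L) ^+ K) a b.
  by rewrite -Ez -!expgnA mulnC.
rewrite (crossingsX (x := z)) => [|k]; rewrite ?Xa //.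
rewrite (crossingsX (x := x ^+ L)) => [|k]; rewrite ?Xa // z2 Ee => E.
have eKL : (e * K = L)%R by lia.
have e_gt0 : (1 <= e)%R.
  by rewrite leNgt; apply/negP => e_lt1; move: eKL L_gt0; nia.
by rewrite -lez_nat -eKL; nia.
Qed.

End PairAction.

(** * Central roots and type A *)

Definition central_roots k (G : groupType) :=
  forall x : G, (forall y, commute x y) -> exists y, x = y ^+ k.

Fixpoint term_pow n (t : term n) k : term n :=
  if k is k'.+1 then Mul t (term_pow t k') else One.

(* Every central element has a k-th root: either y does not commute with x, or
   y is a k-th root of x. *)
Definition root_matrix k : formula 3 :=
  let x := Var (inord 2) in let y := Var (inord 1) in
  Or (Not (Eq (Mul x y) (Mul y x))) (Eq x (term_pow y k)).

Definition root_sentence k : sentence :=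
  Forall (Exists (Forall (root_matrix k))).

Lemma root_sentence_AEA1 k : AEA1 (root_sentence k).
Proof. by exists (root_matrix k). Qed.

Lemma eval_term_pow (G : groupType) n (e : 'I_n -> G) t k :
  eval e (term_pow t k) = eval e t ^+ k.
Proof. by elim: k => //= k ->; rewrite expgS. Qed.

Lemma root_sentenceP k (G : groupType) :
  Th G (root_sentence k) <-> central_roots k G.
Proof.
have var2 (e : 'I_0 -> G) x y z :
    extend (extend (extend e x) y) z (inord 2) = x.
  rewrite /extend (_ : inord 2 = lift ord0 (lift ord0 ord0)) ?liftK /=.
    by rewrite !liftK /= unlift_none.
  by apply/val_inj; rewrite /= inordK.
have var1 (e : 'I_0 -> G) x y z :
    extend (extend (extend e x) y) z (inord 1) = y.
  rewrite /extend (_ : inord 1 = lift ord0 ord0) ?liftK /= ?unlift_none //.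
  by apply/val_inj; rewrite /= inordK.
have matrixE (e : 'I_0 -> G) x y z :
    holds (root_matrix k) (extend (extend (extend e x) y) z) =
    (x * y <> y * x \/ x = y ^+ k).
  by rewrite /= eval_term_pow /= var1 var2.
split=> [ThG x xC|roots e x].
  have e : 'I_0 -> G by case.
  have {}ThG : exists y, forall z,
      holds (root_matrix k) (extend (extend (extend e x) y) z) by exact: ThG.
  have [y /(_ 1)] := ThG; rewrite matrixE => -[[]|->]; last by exists y.
  exact: xC.
suff : exists y, forall z,
  holds (root_matrix k) (extend (extend (extend e x) y) z) by [].
have [xC|xNC] := pselect (forall y, commute x y).
  by have [y ->] := roots x xC; exists y => z; rewrite matrixE; right.
have [y xy] : exists y, ~ commute x y by apply/existsNP.
by exists y => z; rewrite matrixE; left.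
Qed.

Lemma Th_AEA1_central_roots k (G H : groupType) : Th_AEA1 G = Th_AEA1 H ->
  central_roots k G -> central_roots k H.
Proof.
move=> eqGH /root_sentenceP Gk; apply/root_sentenceP.
have : Th_AEA1 G (root_sentence k) by split=> //; exact: root_sentence_AEA1.
by rewrite eqGH => -[].
Qed.

Section Letters.

Variables (r : nat) (lab : nat -> nat -> nat).
Hypothesis lab_gt1 : forall i j, i < j < r -> 1 < lab i j.

Local Notation M := (artin_monoid (@label r lab)).

(* The value is 1 when [r <= i]. *)
Definition letter (i : nat) : M := oapp (gen _) 1 (insub i).

Lemma letterE i (lt_ir : i < r) : letter i = gen _ (Ordinal lt_ir).
Proof. by rewrite /letter insubT. Qed.

Lemma letter_ord (i : 'I_r) : letter i = gen _ i.
Proof. by rewrite letterE; congr (gen _ _); apply: val_inj. Qed.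

Lemma labelE i j (lt_ir : i < r) (lt_jr : j < r) : i < j ->
  @label r lab (Ordinal lt_ir) (Ordinal lt_jr) = lab i j.
Proof.
move=> lt_ij; rewrite /label -val_eqE /= ltn_eqF //.
by rewrite (minn_idPl (ltnW lt_ij)) (maxn_idPr (ltnW lt_ij)).
Qed.

Lemma letter_comm i j : i < j < r -> lab i j = 2 -> commute (letter i) (letter
  j).
Proof.
move=> /andP[lt_ij lt_jr] lab2.
rewrite (letterE lt_jr) (letterE (ltn_trans lt_ij lt_jr)).
by apply: (comm2 (@label_sym r lab) (@label_diag r lab)
  (label_gt1 lab_gt1)); rewrite labelE.
Qed.

Lemma letter_braid3 i j : i < j < r -> lab i j = 3 ->
  letter i * letter j * letter i = letter j * letter i * letter j.
Proof.
move=> /andP[lt_ij lt_jr] lab3.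
rewrite (letterE lt_jr) (letterE (ltn_trans lt_ij lt_jr)).
by apply: (braid3 (@label_sym r lab) (@label_diag r lab)
  (label_gt1 lab_gt1)); rewrite labelE.
Qed.

Lemma letter_braid4 i j : i < j < r -> lab i j = 4 ->
  letter i * letter j * letter i * letter j =
  letter j * letter i * letter j * letter i.
Proof.
move=> /andP[lt_ij lt_jr] lab4.
rewrite (letterE lt_jr) (letterE (ltn_trans lt_ij lt_jr)).
by apply: (braid4 (@label_sym r lab) (@label_diag r lab)
  (label_gt1 lab_gt1)); rewrite labelE.
Qed.

Lemma letters_central (z : M) : (forall i, i < r -> commute z (letter i)) ->
  mcentral z.
Proof.
move=> zC; elim/mword_ind => v; elim: v => [|i v IHv]; first exact: commute1.
by rewrite mword_cons; apply: commuteM => //; rewrite -letter_ord; apply: zC.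
Qed.

Lemma iota_letter i (lt_ir : i < r) :
  iota (letter i) = gword lab [:: Ordinal lt_ir].
Proof. by rewrite letterE iota_mword. Qed.

Lemma neq1_mlen (z : M) : 0 < mlen z -> z <> 1.
Proof. by move=> + z1; rewrite z1 mlen1. Qed.

End Letters.

Lemma interval_connected m (S : nat -> Prop) :
    (forall i, i.+1 < m -> S i <-> S i.+1) ->
  forall i j, i < m -> j < m -> S i -> S j.
Proof.
move=> adjS; have all0 i : i < m -> S i <-> S 0.
  elim: i => // i IHi lt_im; rewrite -IHi ?(ltnW lt_im) //.
  by apply: iff_sym; exact: adjS.
by move=> i j lt_im lt_jm /(all0 i lt_im)/(all0 j lt_jm).
Qed.

(** Arithmetic of a cycle of length [d + 1]: the remainder is the position and the quotient counts
    the returns from [d] to 0. Crossings and turns in powers of [c] are recorded in this form. *)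
Lemma dvdn_succ_mod d m : (d.+1 %| m.+1) = (m %% d.+1 == d).
Proof.
rewrite {1}(divn_eq m d.+1) -addnS dvdn_addr ?dvdn_mull //.
have := ltn_pmod m (ltn0Sn d); rewrite ltnS leq_eqVlt => /orP[/eqP->|lt_md].
  by rewrite dvdnn eqxx.
by rewrite gtnNdvd ?ltnS // ltn_eqF.
Qed.

Lemma modn_succ d m :
  m.+1 %% d.+1 = if m %% d.+1 == d then 0 else (m %% d.+1).+1.
Proof. by rewrite modnS dvdn_succ_mod. Qed.

Lemma divn_succ d m : m.+1 %/ d.+1 = (m %% d.+1 == d) + m %/ d.+1.
Proof. by rewrite divnS // dvdn_succ_mod. Qed.

Section InvolutionWeights.

Variables (Q : eqType) (f g : Q -> Q).
Hypotheses (fK : involutive f) (gK : involutive g).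

Lemma comm_weight a b : (forall c, f (g c) = g (f c)) ->
  ((g a == b : nat)%:Z + (f (g a) == g b : nat))%R =
  ((f a == b : nat)%:Z + (g (f a) == f b : nat))%R.
Proof.
move=> fg; rewrite fg (inj_eq (inv_inj gK)) -fg (inj_eq (inv_inj fK)); lia.
Qed.

Lemma braid_weight a b : (forall c, f (g (f c)) = g (f (g c))) ->
  ((f a == b : nat)%:Z + (g (f a) == f b : nat)
   + (f (g (f a)) == g (f b) : nat))%R =
  ((g a == b : nat)%:Z + (f (g a) == g b : nat)
   + (g (f (g a)) == f (g b) : nat))%R.
Proof.
move=> fg.
have -> : (f (g (f a)) == g (f b)) = (g a == b).
  by rewrite fg (inj_eq (inv_inj gK)) (inj_eq (inv_inj fK)).
have -> : (g (f (g a)) == f (g b)) = (f a == b).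
  by rewrite -fg (inj_eq (inv_inj fK)) (inj_eq (inv_inj gK)).
have -> : (g (f a) == f b) = (f (g a) == g b).
  by rewrite -(inv_eq fK) fg (inv_eq gK).
lia.
Qed.

End InvolutionWeights.

Definition swap i a := if a == i then i.+1 else if a == i.+1 then i else a.

Lemma swapK i : involutive (swap i).
Proof. by move=> a; rewrite /swap; do ![case: eqP => //=]; lia. Qed.

Lemma swapL i : swap i i = i.+1.
Proof. by rewrite /swap eqxx. Qed.

Lemma swapR i : swap i i.+1 = i.
Proof. by rewrite /swap eqxx; case: eqP => //; lia. Qed.

Lemma swapD i a : a != i -> a != i.+1 -> swap i a = a.
Proof. by rewrite /swap => /negPf-> /negPf->. Qed.

Lemma swap_comm i j a : i.+1 < j -> swap i (swap j a) = swap j (swap i a).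
Proof. by move=> lt_ij; rewrite /swap; do ![case: eqP => //=]; lia. Qed.

Lemma swap_braid i a :
  swap i (swap i.+1 (swap i a)) = swap i.+1 (swap i (swap i.+1 a)).
Proof. by rewrite /swap; do ![case: eqP => //=]; lia. Qed.

Section TypeA.

Variable n : nat.
Local Notation G := (artin_A n).
Local Notation M := (artin_monoid (@label n A_label)).

Lemma A_lab_gt1 i j : i < j < n -> 1 < A_label i j.
Proof. by rewrite /A_label; case: ifP. Qed.

Lemma A_cube (i j k : 'I_n) : i != j -> i != k -> j != k ->
  cube_labels (@label n A_label i j) (@label n A_label i k) (@label n A_label j
    k).
Proof.
have labE (a b : 'I_n) : a != b ->
    @label n A_label a b = 2 + ((a.+1 == b) || (b.+1 == a)).
  move=> neq_ab; rewrite /label (negPf neq_ab) /A_label.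
  by move: neq_ab; rewrite -val_eqE /=; case: ifP => H neq_ab; lia.
move=> ij ik jk; rewrite !labE //; move: ij ik jk; rewrite -!val_eqE /=.
move: (val i) (val j) (val k) => {i j k} i j k ij ik jk.
have : ~~ [&& (i.+1 == j) || (j.+1 == i), (i.+1 == k) || (k.+1 == i)
            & (j.+1 == k) || (k.+1 == j)] by lia.
by case: (_ || _); case: (_ || _); case: (_ || _).
Qed.

Lemma A_connected (S : 'I_n -> Prop) : (exists i, S i) ->
  (forall i j, S i -> 2 < @label n A_label i j -> S j) -> forall j, S j.
Proof.
move=> [i Si] adjS j; pose S' k := forall lt_kn : k < n, S (Ordinal lt_kn).
suff S'j : S' j by have := S'j (ltn_ord j); congr S; apply: val_inj.
apply: (@interval_connected n S' _ i) => // [k lt_kn|lt_in]; last first.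
  by congr S: Si; apply: val_inj.
have lt_kn' := ltnW lt_kn.
have lab3 : @label n A_label (Ordinal lt_kn') (Ordinal lt_kn) = 3.
  by rewrite labelE //= /A_label eqxx.
split=> S'k lt; [have := S'k lt_kn' | have := S'k lt_kn].
  by move=> /adjS; apply; rewrite (_ : Ordinal lt = Ordinal lt_kn) ?lab3 //;
    apply: val_inj.
by move=> /adjS; apply; rewrite (_ : Ordinal lt = Ordinal lt_kn') 1?label_sym
  ?lab3 //; apply: val_inj.
Qed.

Let x := letter n A_label.
Let c : M := cox x n 1.
Let zeta := c ^+ n.+1.

Lemma A_zeta_central : mcentral zeta.
Proof.
apply: letters_central => i lt_in; apply: cox_pow_comm => //.
- move=> i' j' lt_ij; apply: letter_comm; [exact: A_lab_gt1|lia|].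
  by rewrite /A_label; case: ifP => //; lia.
- move=> i' lt_i'n; apply: letter_braid3; [exact: A_lab_gt1|lia|].
  by rewrite /A_label eqxx.
- by move=> *; exact/commute_sym/commute1.
- by move=> _; rewrite !mulg1 mul1g.
Qed.

Local Notation act := (word_act (pair_act swap) (pair_act swap)).
Local Notation weight :=
  (word_weight (pair_act swap) (pair_act swap) (pair_weight swap)).

Lemma A_rel_ok (i j : 'I_n) : i < j -> forall p,
  act (alternating i j (A_label i j)) p = act (alternating j i (A_label i j)) p
  /\ weight (alternating i j (A_label i j)) p
    = weight (alternating j i (A_label i j)) p.
Proof.
move=> lt_ij [a b]; rewrite /A_label.
case: eqP => [Ej|/eqP neq_ij];
  rewrite /= /pair_act /pair_weight /= !GRing.add0r.
  rewrite Ej; split; first by rewrite !swap_braid.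
  by apply: (braid_weight (swapK _) (swapK _)) => d; exact: swap_braid.
have sC a' : swap i (swap j a') = swap j (swap i a') by apply: swap_comm; lia.
by rewrite (comm_weight (swapK i) (swapK j)) ?sC.
Qed.

Local Notation pt := (@gpoint n A_label nat swap).
Local Notation cr := (@crossings n A_label nat swap).

Let swK i : i < n -> involutive (swap i).
Proof. by move=> _; exact: swapK. Qed.

Let pt_letter i a : i < n -> pt (iota (x i)) a = swap i a.
Proof. by move=> lt_in; rewrite iota_letter (gpoint_gen swK A_rel_ok). Qed.

Let cr_letter i a b : i < n -> cr (iota (x i)) a b = (swap i a == b).
Proof. by move=> lt_in; rewrite iota_letter (crossings_gen swK A_rel_ok). Qed.

Lemma A_run_point j a : j <= n ->
  pt (iota (run x 0 j)) a = if a < j then a.+1 else if a == j then 0 else a.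
Proof.
elim: j a => [|j IHj] a le_jn.
  by rewrite /run big_geq // iota1 (gpoint1 swK A_rel_ok); case: a.
rewrite /run big_nat_recr //= iotaM (gpointM swK A_rel_ok) pt_letter //.
rewrite IHj ?(ltnW le_jn) // /swap; do ![case: ifP => //=]; lia.
Qed.

Lemma A_run_cross j a b : j <= n -> a != b -> cr (iota (run x 0 j)) a b =
  ((a == j) && (b < j) || (b == j) && (a < j)).
Proof.
elim: j a b => [|j IHj] a b le_jn neq_ab.
  rewrite /run big_geq // iota1 /crossings (gweight1 (pairK swK) (pairK swK)
    A_rel_ok); lia.
rewrite /run big_nat_recr //= iotaM (crossingsM swK A_rel_ok).
rewrite !pt_letter // cr_letter // IHj ?(ltnW le_jn) //; last first.
  by rewrite (inj_eq (inv_inj (swapK _))).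
rewrite /swap; do ![case: ifP => //=]; lia.
Qed.

(** [c] is the cycle a -> a + 1, and a point returning from [n] to 0 crosses every other point once;
    so the crossings of a pair are the turns of its two members. *)
Lemma A_cox_pow t a b : a <= n -> b <= n -> a != b ->
  pt (iota c ^+ t) a = (a + t) %% n.+1 /\
  cr (iota c ^+ t) a b = ((a + t) %/ n.+1 + (b + t) %/ n.+1)%N.
Proof.
have ptX k d : d <= n -> pt (iota c ^+ k) d = (d + k) %% n.+1.
  move=> le_dn; elim: k => [|k IHk].
    by rewrite (gpoint1 swK A_rel_ok) addn0 modn_small.
  rewrite expgS (gpointM swK A_rel_ok) IHk iotaM iota1 mulg1 A_run_point //.
  rewrite addnS modn_succ; have := ltn_pmod (d + k) (ltn0Sn n).
  by do ![case: ifP => //=]; lia.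
move=> le_an le_bn neq_ab; split; first exact: ptX.
elim: t => [|t IHt].
  by rewrite /crossings (gweight1 (pairK swK) (pairK swK) A_rel_ok) !addn0
    !divn_small.
rewrite expgS (crossingsM swK A_rel_ok) IHt !ptX // iotaM iota1 mulg1.
have neq_t : (a + t) %% n.+1 != (b + t) %% n.+1.
  by rewrite -!ptX // (inj_eq (@gpoint_inj _ _ _ _ swK A_rel_ok _)).
rewrite A_run_cross // !addnS !divn_succ.
have := ltn_pmod (a + t) (ltn0Sn n); have := ltn_pmod (b + t) (ltn0Sn n).
by move: neq_t; lia.
Qed.

Lemma A_zeta a b : a <= n -> b <= n -> a != b ->
  pt (iota zeta) a = a /\ cr (iota zeta) a b = 2%R.
Proof.
move=> le_an le_bn neq_ab; rewrite iotaX.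
have [-> ->] := A_cox_pow n.+1 le_an le_bn neq_ab.
by rewrite modnDr !divnDr // divnn /= !divn_small // modn_small.
Qed.

Definition distinct (a b : nat) := a != b.

Let swap_distinct (i : 'I_n) a b : distinct a b -> distinct (swap i a) (swap i
  b).
Proof. by rewrite /distinct (inj_eq (inv_inj (swapK i))). Qed.

Let swap_ltn (i : 'I_n) a b : distinct a b ->
  (swap i a == b) = ((swap i a < swap i b) != (a < b)).
Proof. by rewrite /distinct /swap; do ![case: ifP => //=]; lia. Qed.

Lemma A_zeta_neq1 : 0 < n -> zeta <> 1.
Proof.
move=> n_gt0; apply: neq1_mlen; rewrite /zeta expgS mlenM /c /cox mlenM.
by rewrite run_splitl // mlenM /x (letterE _ n_gt0) mlen_gen.
Qed.

(** For n = 1 the group is infinite cyclic and [zeta] is the square of a generator, whence the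
    condition [1 < n]. *)
Lemma A_central_roots : 1 < n -> central_roots n.+1 G.
Proof.
move=> n_gt1; have n_gt0 := ltnW n_gt1.
have zC := A_zeta_central; have z1 := A_zeta_neq1 n_gt0.
apply: (gcentral_root A_lab_gt1 A_cube A_connected zC z1 (iotaX _ _)).
apply: (mcentral_powers A_lab_gt1 A_cube A_connected zC z1) => g k l gC l_gt0
  Eg.
have g_letter i a : i < n -> pt g (swap i a) = swap i (pt g a).
  move=> lt_in; rewrite -!pt_letter // -!(gpointM swK A_rel_ok).
  by rewrite gC.
have lt1 : n.-1 < n by lia.
have lt2 : n.-2 < n by lia.
have moved i a : i < n -> (swap i (pt g a) == pt g a) = (swap i a == a).
  by move=> lt_in; rewrite -g_letter // (inj_eq (@gpoint_inj _ _ _ _ swK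
    A_rel_ok _)).
(* By [moved], [pt g] preserves the set of points moved by each letter, and [n.-1] is the only point
   moved by both of the last two letters. *)
have ga : pt g n.-1 = n.-1.
  move: (moved n.-1 n.-1 lt1) (moved n.-2 n.-1 lt2); rewrite /swap.
  by do ![case: eqP => //=]; lia.
have gb : pt g n = n.
  have nE : swap n.-1 n.-1 = n by rewrite swapL; lia.
  by have := g_letter _ n.-1 lt1; rewrite ga nE.
have neq_ab : distinct n.-1 n by rewrite /distinct; lia.
have [e] := crossings_parity swK A_rel_ok swap_distinct swap_ltn g neq_ab.
rewrite ga gb eqxx => Ee.
have [za zab] : pt (iota zeta) n.-1 = n.-1 /\ cr (iota zeta) n.-1 n = 2%R.
  by apply: A_zeta => //; lia.
have [zb _] : pt (iota zeta) n = n /\ cr (iota zeta) n n.-1 = 2%R.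
  by apply: A_zeta => //; lia.
have := congr1 (fun h => cr h n.-1 n) Eg.
rewrite /= !(crossingsX swK A_rel_ok) => [|j|j]; rewrite ?iter_fix //.
rewrite zab Ee => El; apply/dvdnP; exists `|e|%N.
by move: El; nia.
Qed.

(* Some power g^L with 0 < L <= n + 1 fixes two points. *)
Lemma A_central_roots_bound k : 0 < n -> central_roots k G -> k <= n.+1.
Proof.
move=> n_gt0 roots.
have [g Eg] : exists g : G, iota zeta = g ^+ k.
  by apply: roots; apply: mcentral_iota; exact: A_zeta_central.
have lt_pt a : a <= n -> pt g a <= n.
  elim/pres_ind: g {Eg} => u; rewrite (gpoint_class swK A_rel_ok) => le_an.
  elim: u => //= -[i e] u; have := ltn_ord i; rewrite /swap /=.
  by do ![case: ifP => //=]; lia.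
pose F (i : 'I_n.+1) := Ordinal (lt_pt i (ltn_ord i) : _ < n.+1).
have F_inj : injective F.
  by move=> i j [] /(@gpoint_inj _ _ _ _ swK A_rel_ok g)/val_inj.
have iterF j i : iter j (pt g) (i : 'I_n.+1) = iter j F i :> nat.
  by elim: j => //= j ->.
have cycle i : iter (order F i) (pt g) i = i.
  by rewrite iterF iter_order.
have order_le i : order F i <= n.+1 by rewrite -[X in _ <= X]card_ord max_card.
have bound (a b : 'I_n.+1) L : a != b -> 0 < L -> iter L (pt g) a = a ->
    iter L (pt g) b = b -> k <= L.
  move=> neq_ab L_gt0 gLa gLb.
  have neq_ba : b != a by rewrite eq_sym.
  have [za zab] := A_zeta (ltn_ord a : a <= n) (ltn_ord b : b <= n) neq_ab.
  have [zb _] := A_zeta (ltn_ord b : b <= n) (ltn_ord a : a <= n) neq_ba.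
  exact: (root_bound swK A_rel_ok swap_distinct swap_ltn (esym Eg) _ L_gt0 za
    zb zab gLa gLb).
have order_gt0 i : 0 < order F i by rewrite order_gt0.
(* Either [g] fixes the point [n], and the length of the cycle of 0 serves as exponent, or the cycle
   of [n] contains the second point [F ord_max]. *)
have [Fmax|Fmax] := eqVneq (F ord_max) ord_max.
  apply: leq_trans (order_le ord0).
  apply: (@bound ord_max ord0 _ _ (order_gt0 ord0)) => //.
    by rewrite -val_eqE /=; lia.
  by rewrite iter_fix //; have := congr1 val Fmax.
apply: leq_trans (order_le ord_max).
apply: (@bound (F ord_max) ord_max _ Fmax (order_gt0 ord_max)) => //.
by rewrite -[LHS]/(iter _ _ (pt g ord_max)) -iterSr /= cycle.
Qed.

End TypeA.

(** * Type B *)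

Section TypeB.

Variable k : nat.
Hypothesis k_gt0 : 0 < k.
Local Notation n := k.+1.
Local Notation G := (artin_B n).
Local Notation M := (artin_monoid (@label n (B_label n))).

Lemma B_lab_gt1 i j : i < j < n -> 1 < B_label n i j.
Proof. by rewrite /B_label; do 2?case: ifP. Qed.

Lemma B_cube (i j l : 'I_n) : i != j -> i != l -> j != l ->
  cube_labels (@label n (B_label n) i j) (@label n (B_label n) i l)
    (@label n (B_label n) j l).
Proof.
pose adj a b := (a.+1 == b) || (b.+1 == a).
have labE (a b : 'I_n) : a != b -> @label n (B_label n) a b =
    2 + adj a b + (adj a b && ((a == k :> nat) || (b == k :> nat))).
  have := ltn_ord a; have := ltn_ord b; rewrite /adj.
  move=> lt_b lt_a neq_ab; rewrite /label (negPf neq_ab) /B_label /=.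
  by move: neq_ab lt_a lt_b; rewrite -val_eqE /=; do 2?case: ifP; lia.
move: (ltn_ord i) (ltn_ord j) (ltn_ord l) => lt_i lt_j lt_l ij il jl.
rewrite !labE //; move: ij il jl; rewrite -!val_eqE /=.
move: (val i) (val j) (val l) lt_i lt_j lt_l => {i j l} i j l ? ? ? ij il jl.
(* In a path no three letters are pairwise adjacent, and its end [k], where the label 4 sits, has a
   single neighbour. *)
have : ~~ [&& adj i j, adj i l & adj j l] by rewrite /adj; lia.
have : [|| i != k, j != k | l != k] by lia.
have : (i == k) ==> ~~ (adj i j && adj i l) by rewrite /adj; lia.
have : (j == k) ==> ~~ (adj i j && adj j l) by rewrite /adj; lia.
have : (l == k) ==> ~~ (adj i l && adj j l) by rewrite /adj; lia.
have : ~~ ((i == k) && (j == k)) && ~~ ((i == k) && (l == k)) && ~~ ((j == k)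
  && (l == k)) by lia.
by case: (adj i j); case: (adj i l); case: (adj j l);
  case: (i == k); case: (j == k); case: (l == k).
Qed.

Lemma B_connected (S : 'I_n -> Prop) : (exists i, S i) ->
  (forall i j, S i -> 2 < @label n (B_label n) i j -> S j) -> forall j, S j.
Proof.
move=> [i Si] adjS j; pose S' l := forall lt_ln : l < n, S (Ordinal lt_ln).
suff S'j : S' j by have := S'j (ltn_ord j); congr S; apply: val_inj.
apply: (@interval_connected n S' _ i) => // [l lt_ln|lt_in]; last first.
  by congr S: Si; apply: val_inj.
have lt_ln' := ltnW lt_ln.
have lab3 : 2 < @label n (B_label n) (Ordinal lt_ln') (Ordinal lt_ln).
  by rewrite labelE //= /B_label eqxx; case: ifP.
split=> S'l lt; [have := S'l lt_ln' | have := S'l lt_ln].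
  by move=> /adjS; apply; rewrite (_ : Ordinal lt = Ordinal lt_ln) //;
    apply: val_inj.
move=> /adjS; apply; rewrite label_sym.
by rewrite (_ : Ordinal lt = Ordinal lt_ln') //; apply: val_inj.
Qed.

Let x := letter n (B_label n).
Let c : M := cox x k (x k).
Let zeta := c ^+ n.

Lemma B_zeta_central : mcentral zeta.
Proof.
have x_comm i j : i.+1 < j < n -> commute (x i) (x j).
  move=> lt_ij; apply: letter_comm; [exact: B_lab_gt1|lia|].
  by rewrite /B_label; case: ifP => //; lia.
have x_braid i : i.+1 < k -> x i * x i.+1 * x i = x i.+1 * x i * x i.+1.
  move=> lt_ik; apply: letter_braid3; [exact: B_lab_gt1|lia|].
  by rewrite /B_label eqxx /=; case: ifP => //; lia.
have T_comm i : i.+1 < k -> commute (x k) (x i).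
  by move=> lt_ik; apply/commute_sym/x_comm; lia.
have x_comm' i j : i.+1 < j < k -> commute (x i) (x j).
  by move=> lt_ij; apply: x_comm; lia.
have T_braid : 0 < k -> x k.-1 * x k * x k.-1 * x k = x k * x k.-1 * x k * x
  k.-1.
  move=> _; apply: letter_braid4; [exact: B_lab_gt1|lia|].
  by rewrite /B_label /= prednK // !eqxx.
apply: letters_central => i; rewrite ltnS leq_eqVlt => /orP[/eqP->|lt_ik].
  apply: cox_pow_comm_tail => //.
  by move=> u v w; apply: (amon_mulI B_lab_gt1 B_cube).

exact: cox_pow_comm.
Qed.

Lemma B_zeta_neq1 : zeta <> 1.
Proof.
apply: neq1_mlen; rewrite /zeta expgS mlenM /c /cox mlenM.
by rewrite run_splitl // mlenM /x (letterE _ (ltn0Sn k)) mlen_gen.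
Qed.

(** Braids around an axis: the last letter takes the strand in position [k] once around the axis and
    back to its place, and [B_weight] counts these turns. *)
Definition B_act i a := if i == k then a else swap i a.
Definition B_weight i (a : nat) : int := ((i == k) && (a == k) : nat).

Let actK i : i < n -> cancel (B_act i) (B_act i).
Proof. by move=> _ a; rewrite /B_act; case: (i == k); rewrite ?swapK. Qed.

Lemma B_rel_ok (i j : 'I_n) : i < j -> forall p,
  word_act B_act B_act (alternating i j (B_label n i j)) p
    = word_act B_act B_act (alternating j i (B_label n i j)) p
  /\ word_weight B_act B_act B_weight (alternating i j (B_label n i j)) p
    = word_weight B_act B_act B_weight (alternating j i (B_label n i j)) p.
Proof.
move=> lt_ij p; have lt_jn := ltn_ord j; rewrite /B_label.
case: eqP => [Ej|/eqP neq_ij]; last first.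
  rewrite /= /B_act /B_weight; case: (eqVneq (j : nat) k) => [Ejk|neq_jk].
    have ik : (i == k :> nat) = false by lia.
    by rewrite ik ?Ejk /= !GRing.add0r GRing.addr0 /swap; split=> //;
      do ![case: eqP => //=]; lia.
  have ik : (i == k :> nat) = false by lia.
  by rewrite ik /=; split=> //; rewrite swap_comm //; lia.
have ik : (i == k :> nat) = false by lia.
case: eqP => /= Ejk; rewrite /B_act /B_weight ik.
  by rewrite Ejk eqxx /= swapK; split=> //; lia.
have jk : (j == k :> nat) = false by lia.
by rewrite jk /= Ej swap_braid.
Qed.

Local Notation ga := (@gact n (B_label n) nat B_act B_act).
Local Notation gw := (@gweight n (B_label n) nat B_act B_act B_weight).

Lemma B_letter i a : i < n -> ga (iota (x i)) a = B_act i a /\ gw (iota (x i))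
  a = B_weight i a.
Proof.
move=> lt_in; rewrite iota_letter (gact_class actK actK B_rel_ok).
by rewrite (gweight_class actK actK B_rel_ok) /= GRing.add0r.
Qed.

Lemma B_run j a : j <= k ->
  ga (iota (run x 0 j)) a = (if a < j then a.+1 else if a == j then 0 else a) /\
  gw (iota (run x 0 j)) a = 0%R.
Proof.
elim: j a => [|j IHj] a le_jk.
  rewrite /run big_geq // iota1 (gact1 actK actK B_rel_ok).
  by rewrite (gweight1 actK actK B_rel_ok); case: a.
rewrite /run big_nat_recr //= iotaM.
rewrite (gactM actK actK B_rel_ok) (gweightM actK actK B_rel_ok).
have [|-> ->] := @B_letter j a; first by lia.
have [-> ->] := IHj (B_act j a) (ltnW le_jk).
rewrite /B_act /B_weight; have -> : (j == k) = false by lia.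
by rewrite /= /swap; split; do ?[case: ifP => //=]; lia.
Qed.

Lemma B_cox_pow t a : a < n ->
  ga (iota c ^+ t) a = (a + t) %% n /\ gw (iota c ^+ t) a = ((a + t) %/ n)%N.
Proof.
move=> lt_an; elim: t => [|t [IH1 IH2]].
  rewrite (gact1 actK actK B_rel_ok) (gweight1 actK actK B_rel_ok).
  by rewrite addn0 modn_small ?divn_small.
rewrite expgS (gactM actK actK B_rel_ok) (gweightM actK actK B_rel_ok) IH1 IH2.
rewrite iotaM (gactM actK actK B_rel_ok) (gweightM actK actK B_rel_ok).
have [//|-> ->] := @B_letter k ((a + t) %% n).
rewrite /B_act /B_weight eqxx /=.
have [-> ->] := B_run ((a + t) %% n) (leqnn k).
rewrite addnS modn_succ divn_succ.
have := ltn_pmod (a + t) (ltn0Sn k).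
by split; do ?[case: ifP => //=]; lia.
Qed.

Lemma B_central_roots : central_roots n G.
Proof.
have zC := B_zeta_central; have z1 := B_zeta_neq1.
apply: (gcentral_root B_lab_gt1 B_cube B_connected zC z1 (iotaX _ _)).
apply: (mcentral_powers B_lab_gt1 B_cube B_connected zC z1) => g u l gC l_gt0
  Eg.
(* The last letter has weight 1 at [k] and 0 elsewhere; comparing the weights of [g * x k] and
   [x k * g] at [k] shows that [g] keeps [k]. *)
have gk : ga g k = k.
  have := congr1 (fun h => gw h k) (gC (iota (x k))).
  rewrite /= !(gweightM actK actK B_rel_ok).
  have [//|-> ->] := @B_letter k k; have [//|_ ->] := @B_letter k (ga g k).
  by rewrite /B_weight /B_act !eqxx /=; lia.
have [zk zwk] : ga (iota zeta) k = k /\ gw (iota zeta) k = 1%R.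
  rewrite iotaX; have [//|-> ->] := @B_cox_pow n k.
  by rewrite modnDr divnDr // divnn /= divn_small // modn_small.
have := congr1 (fun h => gw h k) Eg.
rewrite /= !(gweightX_fix actK actK B_rel_ok) // zwk => El.
apply/dvdnP; exists `|gw g k|%N.
by have := congr1 absz El; rewrite !abszM /=; lia.
Qed.

End TypeB.

(** * Letter counts and type I2 *)

Section LetterCount.

(** Weighted letter counts, realized as a weighted action on one point. The two sides of an odd
    relation have different letters in excess, so these must have equal weight; an even relation is
    balanced. *)
Variables (r : nat) (lab : nat -> nat -> nat) (w : nat -> nat).
Hypothesis w_odd : forall i j, i < j < r -> odd (lab i j) -> w i = w j.

Local Notation G := (artin (@diagram r lab)).

Let act (i : nat) (p : unit) := p.
Let weight (i : nat) (p : unit) : int := w i.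

Let weight_alt (i j : 'I_r) m : word_weight act act weight (alternating i j m)
  tt
  = (uphalf m * w i + m./2 * w j)%N.
Proof. by elim: m i j => //= m IHm i j; rewrite IHm /weight; lia. Qed.

Let rel_ok (i j : 'I_r) : i < j -> forall p,
  word_act act act (alternating i j (lab i j)) p
    = word_act act act (alternating j i (lab i j)) p
  /\ word_weight act act weight (alternating i j (lab i j)) p
    = word_weight act act weight (alternating j i (lab i j)) p.
Proof.
move=> lt_ij []; split; first by case: (word_act _ _ _ _);
  case: (word_act _ _ _ _).
rewrite !weight_alt; have [odd_ij|even_ij] := boolP (odd (lab i j)).
  by rewrite (w_odd _ odd_ij) ?lt_ij ?ltn_ord // addnC.
by rewrite uphalf_half (negPf even_ij) addnC.
Qed.

Let actK i : i < r -> cancel (act i) (act i). Proof. by []. Qed.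

Definition gcount (g : G) := gweight act act weight g tt.

Lemma gcountM g h : gcount (g * h) = (gcount g + gcount h)%R.
Proof.
by rewrite /gcount (gweightM actK actK rel_ok); case: (gact _ _ _ _);
  rewrite GRing.addrC.
Qed.

Lemma gcount1 : gcount 1 = 0%R.
Proof. exact: (gweight1 actK actK rel_ok). Qed.

Lemma gcountX g k : gcount (g ^+ k) = (gcount g * k)%R.
Proof.
by apply: (gweightX_fix actK actK rel_ok); case: (gact _ _ _ _).
Qed.

Lemma gcount_letter i : i < r -> gcount (iota (letter r lab i)) = w i.
Proof.
move=> lt_ir; rewrite iota_letter /gcount (gweight_class actK actK rel_ok) /=.
by rewrite GRing.add0r.
Qed.

Lemma gcount_root (z : G) (m k : nat) : gcount z = m -> (forall y, commute z y)
  ->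
  central_roots k G -> k %| m.
Proof.
move=> zm zC /(_ z zC)[g Eg]; apply/dvdnP; exists `|gcount g|%N.
by have := congr1 absz zm; rewrite Eg gcountX abszM /=; lia.
Qed.

End LetterCount.

(** The last letter meets only even labels, so it can be counted alone; it occurs [n] times in
    [zeta]. *)
Lemma B_central_roots_bound n k : 2 <= n -> central_roots k (artin_B n) -> k <=
  n.
Proof.
case: n => // n n_gt0; set w := fun i : nat => (i == n : nat).
have w_odd i j : i < j < n.+1 -> odd (B_label n.+1 i j) -> w i = w j.
  rewrite /B_label /w; case: eqP => // Ej; case: eqP => //= Ejn /andP[? ?] _;
    lia.
move=> roots; apply: dvdn_leq => //.
apply: (gcount_root w_odd _ (mcentral_iota (B_zeta_central n_gt0)) roots).
rewrite iotaX (gcountX w_odd) iotaM (gcountM w_odd) (gcount_letter w_odd) //.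
suff run0 j : j <= n -> gcount w (iota (run (letter n.+1 (B_label n.+1)) 0 j))
  = 0%R.
  by rewrite run0 // /w eqxx; lia.
elim: j => [|j IHj] le_jn; first by rewrite /run big_geq // iota1 (gcount1
  w_odd).
rewrite /run big_nat_recr //= iotaM (gcountM w_odd) IHj ?(ltnW le_jn) //.
by rewrite (gcount_letter w_odd) /w; lia.
Qed.

Section TypeI2.

Variable n : nat.
Hypothesis n_gt2 : 2 < n.
Local Notation G := (artin_I2 n).
Local Notation lab := (fun _ _ : nat => n).
Local Notation M := (artin_monoid (@label 2 lab)).

Lemma I2_lab_gt1 i j : i < j < 2 -> 1 < lab i j.
Proof. by move=> _; exact: ltnW. Qed.

Lemma I2_cube (i j k : 'I_2) : i != j -> i != k -> j != k ->
  cube_labels (@label 2 lab i j) (@label 2 lab i k) (@label 2 lab j k).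
Proof.
rewrite -!val_eqE /=; have := ltn_ord i; have := ltn_ord j; have := ltn_ord k;
  lia.
Qed.

Lemma I2_connected (S : 'I_2 -> Prop) : (exists i, S i) ->
  (forall i j, S i -> 2 < @label 2 lab i j -> S j) -> forall j, S j.
Proof.
move=> [i Si] adjS j; have [<- //|neq_ij] := eqVneq i j.
by apply: adjS Si _; rewrite /label (negPf neq_ij).
Qed.

Let i0 : 'I_2 := ord0.
Let i1 : 'I_2 := ord_max.
Let a : M := gen _ i0.
Let b : M := gen _ i1.
Let Delta : M := mword _ (alt i0 i1 n).
Let h := n./2.

Let alt_even (i j : 'I_2) k : mword (@label 2 lab) (alt i j k.*2)
  = (gen _ i * gen _ j) ^+ k.
Proof.
by elim: k => //= k IHk; rewrite !mword_cons IHk expgS !mulgA.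
Qed.

Let alt_odd (i j : 'I_2) k : mword (@label 2 lab) (alt i j k.*2.+1)
  = (gen _ i * gen _ j) ^+ k * gen _ i.
Proof.
elim: k => [|k IHk]; first by rewrite mul1g.
have -> : alt i j k.+1.*2.+1 = i :: j :: alt i j k.*2.+1 by rewrite doubleS.
by rewrite 2!mword_cons IHk expgS !mulgA.
Qed.

Let conj_pow (u v : M) k : u * (v * u) ^+ k = (u * v) ^+ k * u.
Proof.
elim: k => [|k IHk]; first by rewrite mulg1 mul1g.
by rewrite !expgS -!mulgA IHk !mulgA.
Qed.

Let Delta_sym : Delta = mword _ (alt i1 i0 n).
Proof. by apply/mwordP/(braid_rel (@label 2 lab)). Qed.

Let Delta_comm : ~~ odd n -> mcentral Delta.
Proof.
move=> n_even; have altE i j : alt i j n = alt i j h.*2.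
  by congr (alt _ _ _); have := odd_double_half n; rewrite /h; lia.
have E1 : Delta = (a * b) ^+ h by rewrite /Delta altE alt_even.
have E2 : Delta = (b * a) ^+ h by rewrite Delta_sym altE alt_even.
elim/mword_ind => v; elim: v => [|i v IHv]; first exact: commute1.
rewrite mword_cons; apply: commuteM => //.
have [->|->] : i = i0 \/ i = i1.
  by have := ltn_ord i; case: (posnP i) => ?; [left|right];
    apply: val_inj => /=; lia.
- by rewrite /commute {1}E1 E2 conj_pow.
- by rewrite /commute {1}E2 E1 conj_pow.
Qed.

Let Delta_conj : odd n -> a * Delta = Delta * b /\ b * Delta = Delta * a.
Proof.
move=> n_odd; have altE i j : alt i j n = alt i j h.*2.+1.
  by congr (alt _ _ _); have := odd_double_half n; rewrite /h; lia.
have E1 : Delta = (a * b) ^+ h * a by rewrite /Delta altE alt_odd.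
have E2 : Delta = (b * a) ^+ h * b by rewrite Delta_sym altE alt_odd.
split; [rewrite {1}E2 E1|rewrite {1}E1 E2]; by rewrite mulgA conj_pow -!mulgA.
Qed.

Let letters (P : 'I_2 -> Prop) : P i0 -> P i1 -> forall i, P i.
Proof.
move=> P0 P1 i; have := ltn_ord i; case: (posnP i) => Ei lt_i2.
  by rewrite (_ : i = i0) //; apply: val_inj.
by rewrite (_ : i = i1) //; apply: val_inj => /=; lia.
Qed.

Let zeta : M := if odd n then Delta ^+ 2 else Delta.

Let gens_central (z : M) : commute z a -> commute z b -> mcentral z.
Proof.
move=> za zb; elim/mword_ind => v; elim: v => [|i v IHv]; first exact: commute1.
by rewrite mword_cons; apply: commuteM => //; move: i; apply: letters.
Qed.

Let zetaC : mcentral zeta.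
Proof.
rewrite /zeta; case: ifP => [n_odd|/negbT]; last exact: Delta_comm.
have [aD bD] := Delta_conj n_odd.
by apply: gens_central; rewrite /commute expg2 -mulgA -?aD -?bD !mulgA ?aD ?bD.
Qed.

Let Delta_neq1 : Delta <> 1.
Proof. by apply: neq1_mlen; rewrite mlen_mword size_alt; lia. Qed.

Let zeta_neq1 : zeta <> 1.
Proof.
rewrite /zeta; case: ifP => // _; apply: neq1_mlen.
by rewrite expg2 mlenM mlen_mword size_alt; lia.
Qed.

(** The root [D] is divisible by both letters, hence by their lcm [Delta], and [Delta] is in turn a
    power of [D]; by lengths, [D = Delta]. *)
Let central_Delta (p : M) : mcentral p -> exists k, p = Delta ^+ k.
Proof.
have [D [D1 Dcd Dpow]] := central_divisor_basis I2_lab_gt1 I2_cube I2_connected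
  zetaC zeta_neq1.
have Dcd' : central_divisor (gen (@label 2 lab)) Delta.
  split; last first.
    exists zeta => //; rewrite /zeta; case: ifP => _; last by exists 1;
      rewrite mulg1.
    by exists Delta.
  case: (boolP (odd n)) => [/Delta_conj[aD bD]|/Delta_comm DC] i;
    last by exists i; rewrite DC.
  by move: i; apply: letters; [exists i1|exists i0].
have [v Dv] : divides Delta D.
  have divD i := amon_central_divides I2_lab_gt1 I2_cube I2_connected i Dcd.1
    D1.
  have [[u Eu] [v Ev]] := (divD i0, divD i1).
  have [w [Ew _]] := artin_reduction I2_lab_gt1 I2_cube (etrans (esym Eu) Ev).
  by exists w; rewrite Eu Ew mulgA (gen_compl (@label_diag 2 lab) (label_gt1
    I2_lab_gt1)).
have [e Ee] := Dpow _ Dcd'.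
have v1 : v = 1.
  case: e Ee => [/Delta_neq1//|e]; rewrite expgS Dv => /(congr1 (@mlen _ _)).
  rewrite !mlenM => El.
  case: (amon_genP v) => // -[i [y Ey]]; move: El; rewrite Ey mlenM mlen_gen;
    lia.
move=> pC; have [|k ->] := Dpow p; last by exists k; rewrite Dv v1 mulg1.
split; first exact: central_quasi_central.
by exists p => //; exists 1; rewrite mulg1.
Qed.

Let central_zeta (p : M) : mcentral p -> exists k, p = zeta ^+ k.
Proof.
move=> pC; have [k Ek] := central_Delta pC.
case: (boolP (odd n)) => n_odd; rewrite /zeta ?n_odd ?(negPf n_odd);
  last by exists k.
exists k./2; rewrite -expgnA mul2n.
have := odd_double_half k; case: (odd k) => /esym k_odd;
  last by rewrite Ek {1}k_odd.
have [aD _] := Delta_conj n_odd.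
(* For odd [n], [Delta] exchanges the two letters, so a central odd power of [Delta] would identify
   them. *)
have /artin_gen_inj : gen (@label 2 lab) i0 = gen _ i1.
  apply: (amon_mulI I2_lab_gt1 I2_cube (x := p)).
  rewrite (pC (gen _ i0)) Ek k_odd add1n expgSr.
  have zk : mcentral (Delta ^+ k./2.*2).
    move=> y; rewrite -mul2n expgnA; have := zetaC; rewrite /zeta n_odd => zC.
    exact/commute_sym/commuteX/commute_sym/zC.
  by rewrite mulgA -(zk a) -!mulgA aD.
by move=> /(_ I2_lab_gt1 I2_cube).
Qed.

(** For odd n = 2 h + 1, the two factors [Delta] are spelled from different first letters, as (a
    b)^h a and (b a)^h b, so that together they read (a b)^n. *)
Let zetaE : zeta = (a * b) ^+ (if odd n then n else h).
Proof.
rewrite /zeta; case: ifP => n_odd; last first.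
  have altE i j : alt i j n = alt i j h.*2.
    by congr (alt _ _ _); have := odd_double_half n; rewrite /h; lia.
  by rewrite /Delta altE alt_even.
have altE i j : alt i j n = alt i j h.*2.+1.
  by congr (alt _ _ _); have := odd_double_half n; rewrite /h; lia.
have nE : n = (h + h).+1 by have := odd_double_half n; rewrite /h; lia.
rewrite expg2 {2}Delta_sym /Delta !altE !alt_odd -/a -/b.
rewrite -mulgA (mulgA a) conj_pow -mulgA -expgSr -expgnDr.
by congr (_ ^+ _); lia.
Qed.

Lemma I2_central_roots : central_roots (if odd n then n else n./2) G.
Proof.
apply: (gcentral_root I2_lab_gt1 I2_cube I2_connected zetaC zeta_neq1 _
  central_zeta).
by rewrite zetaE iotaX.
Qed.

(** For odd [n] both letters have the same weight and the whole length 2 n of [zeta] is counted; for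
    even [n] the letter [b] is counted alone and occurs n / 2 times. *)
Lemma I2_central_roots_dvd k : central_roots k G ->
  k %| if odd n then n.*2 else n./2.
Proof.
pose w i := if odd n then 1%N else (i == 1%N : nat).
have w_odd i j : i < j < 2 -> odd n -> w i = w j by move=> _; rewrite /w => ->.
apply: (gcount_root w_odd _ (mcentral_iota zetaC)).
have [aE bE] : a = letter 2 lab 0 /\ b = letter 2 lab 1.
  by rewrite /a /b !letterE; split; congr (gen _ _); apply: val_inj.
rewrite zetaE iotaX (gcountX w_odd) iotaM (gcountM w_odd) aE bE.
by rewrite !(gcount_letter w_odd) // /w; case: ifP => _ /=; rewrite /h; lia.
Qed.

End TypeI2.

(** * Type D *)

Section TypeD.

Variable k : nat.
Hypothesis k_gt0 : 0 < k.
Local Notation n := k.+2.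
Local Notation G := (artin_D n).
Local Notation lab := (D_label n).
Local Notation M := (artin_monoid (@label n lab)).

Lemma D_labE i j : lab i j =
  2 + (if j == k.+1 then i == k.-1 else j == i.+1).
Proof.
rewrite /D_label /= (_ : k.+2 - 3 = k.-1)%N; last by lia.
by case: eqP => _; case: eqP.
Qed.

Lemma D_lab_gt1 i j : i < j < n -> 1 < lab i j.
Proof. by rewrite D_labE. Qed.

Lemma D_cube (i j l : 'I_n) : i != j -> i != l -> j != l ->
  cube_labels (@label n lab i j) (@label n lab i l) (@label n lab j l).
Proof.
pose adj a b := if b == k.+1 then a == k.-1 else
  if a == k.+1 then b == k.-1 else (a.+1 == b) || (b.+1 == a).
have labE (a b : 'I_n) : a != b -> @label n lab a b = 2 + adj a b.
  have := ltn_ord a; have := ltn_ord b; rewrite /adj.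
  move=> lt_b lt_a neq_ab; rewrite /label (negPf neq_ab) D_labE /=.
  by move: neq_ab lt_a lt_b; rewrite -val_eqE /=; do ?[case: ifP]; lia.
move: (ltn_ord i) (ltn_ord j) (ltn_ord l) => lt_i lt_j lt_l ij il jl.
rewrite !labE //; move: ij il jl; rewrite -!val_eqE /=.
move: (val i) (val j) (val l) lt_i lt_j lt_l => {i j l} i j l ? ? ? ij il jl.
have : ~~ [&& adj i j, adj i l & adj j l].
  by rewrite /adj; do ![case: eqP => //=]; lia.
by case: (adj i j); case: (adj i l); case: (adj j l).
Qed.

Lemma D_connected (S : 'I_n -> Prop) : (exists i, S i) ->
  (forall i j, S i -> 2 < @label n lab i j -> S j) -> forall j, S j.
Proof.
move=> [i Si] adjS; pose S' l := forall lt_ln : l < n, S (Ordinal lt_ln).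
have S'P (l : 'I_n) : S' l <-> S l.
  split=> [S'l|Sl lt_ln]; last by congr S: Sl; apply: val_inj.
  by have := S'l (ltn_ord l); congr S; apply: val_inj.
have S'adj a b : a < b -> b < n -> 2 < lab a b -> S' a <-> S' b.
  move=> lt_ab lt_bn gt2; have lt_an := ltn_trans lt_ab lt_bn.
  have gt2' : 2 < @label n lab (Ordinal lt_an) (Ordinal lt_bn) by rewrite
    labelE.
  rewrite -[a]/(val (Ordinal lt_an)) -[b]/(val (Ordinal lt_bn)) !S'P.
  by split=> /adjS; apply; rewrite // label_sym.
have S'path a b : a < k.+1 -> b < k.+1 -> S' a -> S' b.
  apply: interval_connected => l lt_lk; apply: S'adj; rewrite ?D_labE; try lia.
  by rewrite eqxx; case: ifP; lia.
have S'last : S' k.-1 <-> S' k.+1 by apply: S'adj; rewrite ?D_labE ?eqxx //;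
  lia.
have S'k : S' k.-1.
  move: Si => /S'P; have := ltn_ord i; rewrite ltnS leq_eqVlt =>
    /orP[/eqP->|lt_ik].
    by move=> /S'last.
  by apply: S'path => //; lia.
move=> j; apply/S'P; have := ltn_ord j.
rewrite ltnS leq_eqVlt => /orP[/eqP->|lt_jk]; first exact/S'last.
by apply: S'path S'k => //; lia.
Qed.

Let x := letter n lab.
Let p := x k.
Let q := x k.+1.
Let c : M := cox x k (p * q).

Let x_comm i j : i < j < n -> lab i j = 2 -> commute (x i) (x j).
Proof. by move=> lt_ij; apply: letter_comm => //; exact: D_lab_gt1. Qed.

Let x_braid i j : i < j < n -> lab i j = 3 ->
  x i * x j * x i = x j * x i * x j.
Proof. by move=> lt_ij; apply: letter_braid3 => //; exact: D_lab_gt1. Qed.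

Let pq_comm : commute p q.
Proof. by apply: x_comm; rewrite ?D_labE ?eqxx //; lia. Qed.

Let p_braid : x k.-1 * p * x k.-1 = p * x k.-1 * p.
Proof. by apply: x_braid; rewrite ?D_labE; [|case: ifP]; lia. Qed.

Let q_braid : x k.-1 * q * x k.-1 = q * x k.-1 * q.
Proof. by apply: x_braid; rewrite ?D_labE ?eqxx //; lia. Qed.

Let p_comm i : i.+1 < k -> commute p (x i).
Proof.
by move=> lt_ik; apply/commute_sym/x_comm; rewrite ?D_labE; [|case: ifP]; lia.
Qed.

Let q_comm i : i.+1 < k -> commute q (x i).
Proof. by move=> lt_ik; apply/commute_sym/x_comm; rewrite ?D_labE ?eqxx;
  lia. Qed.

Let run_comm i j : i.+1 < j < k -> commute (x i) (x j).
Proof. by move=> lt_ij; apply: x_comm; rewrite ?D_labE; [|case: ifP]; lia. Qed.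

Let run_braid i : i.+1 < k -> x i * x i.+1 * x i = x i.+1 * x i * x i.+1.
Proof. by move=> lt_ik; apply: x_braid; rewrite ?D_labE; [|case: ifP]; lia. Qed.

Let T_comm i : i.+1 < k -> commute (p * q) (x i).
Proof.
by move=> lt_ik; apply/commute_sym/commuteM; apply: commute_sym;
  [exact: p_comm|exact: q_comm].
Qed.

Let T_braid : 0 < k ->
  x k.-1 * (p * q) * x k.-1 * (p * q) = p * q * x k.-1 * (p * q) * x k.-1.
Proof.
move=> _; set a := x k.-1.
have pap (y : M) : p * (a * (p * y)) = a * (p * (a * y)).
  by rewrite !mulgA p_braid.
have qaq (y : M) : q * (a * (q * y)) = a * (q * (a * y)).
  by rewrite !mulgA q_braid.
have pqx (y : M) : p * (q * y) = q * (p * y) by rewrite !mulgA pq_comm.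
have qa : a * (q * a) = q * (a * q) by rewrite !mulgA q_braid.
rewrite -!mulgA (pqx (a * (p * q))) pap -qaq.
by rewrite (pqx (a * (p * (q * a)))) pap qa (pqx (a * q)).
Qed.

Let cK i : i < k -> commute (c ^+ k.+1) (x i).
Proof. exact: cox_pow_comm. Qed.

Let cp : c ^+ k.+1 * p = (if odd k then q else p) * c ^+ k.+1.
Proof. exact: cox_fork_pow. Qed.

Let cq : c ^+ k.+1 * q = (if odd k then p else q) * c ^+ k.+1.
Proof. by apply: cox_fork_pow => //; exact: pq_comm. Qed.

(** For odd [k], c^(k+1) exchanges the leaves [p] and [q], and has to be squared. *)
Let zeta := (c ^+ k.+1) ^+ (odd k).+1.

Lemma D_zeta_central : mcentral zeta.
Proof.
apply: letters_central => i lt_in; case: (ltnP i k) => [lt_ik|le_ki].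
  exact/commute_sym/commuteX/commute_sym/cK.
have [->|->] : i = k \/ i = k.+1 by lia.
all: rewrite -/p -/q /zeta /commute; move: cp cq; case: (odd k) => /= Ep Eq.
- by rewrite expg2 -mulgA Ep mulgA Eq mulgA.
- by rewrite expg1.
- by rewrite expg2 -mulgA Eq mulgA Ep mulgA.
- by rewrite expg1.
Qed.

Lemma D_zeta_neq1 : zeta <> 1.
Proof.
apply: neq1_mlen; rewrite /zeta -expgnA mulSn addSn expgS mlenM /c /cox mlenM.
by rewrite run_splitl // !mlenM /x (letterE _ (ltn0Sn k.+1)) mlen_gen.
Qed.

(* The signed point [(a, e)] is a when e is false, and - a otherwise. *)
Definition D_point i (a : nat * bool) : nat * bool :=
  if i == k.+1 then (swap k a.1, a.2 (+) ((a.1 == k) || (a.1 == k.+1)))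
  else (swap i a.1, a.2).

Let swap_last a : ((swap k a == k) || (swap k a == k.+1)) = ((a == k) || (a ==
  k.+1)).
Proof. by rewrite /swap; do ![case: eqP => //=]; lia. Qed.

Let DK i : i < n -> involutive (D_point i).
Proof.
move=> _ [a e]; rewrite /D_point; case: (i == k.+1) => /=; rewrite ?swapK //.
by rewrite swap_last -addbA addbb addbF.
Qed.

Lemma D_point_comm i j b : i < j < n -> lab i j = 2 ->
  D_point i (D_point j b) = D_point j (D_point i b).
Proof.
rewrite D_labE => /andP[lt_ij lt_jn]; case: b => b e; rewrite /D_point.
have -> : (i == k.+1) = false by lia.
case: (eqVneq j k.+1) => [Ej|neq_jk] /=; last first.
  by case: (eqVneq j i.+1) => // neq_ij _; rewrite swap_comm //; lia.
move=> H; have [->|lt_ik] : i = k \/ i.+1 < k by case: eqP H; lia.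
  by rewrite swap_last.
rewrite swap_comm //; congr (_, _ (+) _).
by rewrite /swap; do ![case: eqP => //=]; lia.
Qed.

Lemma D_point_braid i j b : i < j < n -> lab i j = 3 ->
  D_point i (D_point j (D_point i b)) = D_point j (D_point i (D_point j b)).
Proof.
rewrite D_labE => /andP[lt_ij lt_jn]; case: b => b e; rewrite /D_point.
have -> : (i == k.+1) = false by lia.
case: (eqVneq j k.+1) => [Ej|neq_jk] /=; last first.
  by case: (eqVneq j i.+1) => // -> _; rewrite swap_braid.
move=> H; have Ei : k = i.+1 by case: eqP H; lia.
rewrite Ei swap_braid; congr (_, _).
by rewrite /swap; do ![case: eqP => //=]; case: e => //=; lia.
Qed.

Local Notation act := (word_act (pair_act D_point) (pair_act D_point)).
Local Notation weight :=
  (word_weight (pair_act D_point) (pair_act D_point) (pair_weight D_point)).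

Lemma D_rel_ok (i j : 'I_n) : i < j -> forall b,
  act (alternating i j (lab i j)) b = act (alternating j i (lab i j)) b
  /\ weight (alternating i j (lab i j)) b = weight (alternating j i (lab i j))
    b.
Proof.
move=> lt_ij [a b]; have lt_ijn : i < j < n by rewrite lt_ij ltn_ord.
have [lab2|lab3] : lab i j = 2 \/ lab i j = 3.
  by rewrite D_labE; case: (if _ then _ else _); [right|left].
- have C d := D_point_comm d lt_ijn lab2.
  rewrite lab2 /= /pair_act /pair_weight /= !GRing.add0r !C.
  by rewrite -(comm_weight (DK (ltn_ord i)) (DK (ltn_ord j))) ?C.
- have B d := D_point_braid d lt_ijn lab3.
  rewrite lab3 /= /pair_act /pair_weight /= !GRing.add0r.
  split; first by rewrite !B.
  by apply: (braid_weight (DK (ltn_ord i)) (DK (ltn_ord j))) => d; exact: B.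
Qed.

Local Notation pt := (@gpoint n lab _ D_point).
Local Notation cr := (@crossings n lab _ D_point).

Let pt_letter i a : i < n -> pt (iota (x i)) a = D_point i a.
Proof. by move=> lt_in; rewrite iota_letter (gpoint_gen DK D_rel_ok). Qed.

Let cr_letter i a b : i < n -> cr (iota (x i)) a b = (D_point i a == b).
Proof. by move=> lt_in; rewrite iota_letter (crossings_gen DK D_rel_ok). Qed.

Let ptM (g h : G) a : pt (g * h) a = pt g (pt h a).
Proof. exact: (gpointM DK D_rel_ok). Qed.

Let crM (g h : G) a b : cr (g * h) a b = (cr h a b + cr g (pt h a) (pt h b))%R.
Proof. exact: (crossingsM DK D_rel_ok). Qed.

Let pt1 a : pt 1 a = a.
Proof. exact: (gpoint1 DK D_rel_ok). Qed.

Let cr1 a b : cr 1 a b = 0%R.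
Proof. exact: (gweight1 (pairK DK) (pairK DK) D_rel_ok). Qed.

Let pt_inj g : injective (pt g).
Proof. exact: gpoint_inj DK D_rel_ok g. Qed.

Lemma D_run j a : j <= k -> pt (iota (run x 0 j)) a =
  ((if a.1 < j then a.1.+1 else if a.1 == j then 0 else a.1), a.2).
Proof.
case: a => a e /=; elim: j a => [|j IHj] a le_jk.
  by rewrite /run big_geq // iota1 pt1; case: a.
rewrite /run big_nat_recr //= iotaM ptM pt_letter; last by lia.
rewrite /D_point (_ : (j == k.+1) = false) /=; last by lia.
by rewrite IHj ?(ltnW le_jk) // /swap; congr (_, _); do ![case: ifP => //=];
  lia.
Qed.

Lemma D_run_cross j a b : j <= k -> a.1 <= k -> b.1 = k.+1 ->
  cr (iota (run x 0 j)) a b = 0%R.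
Proof.
move: a b => [a e] [_ d] /= + + ->; elim: j a => [|j IHj] a le_jk le_ak.
  by rewrite /run big_geq // iota1 cr1.
rewrite /run big_nat_recr //= iotaM crM cr_letter; last by lia.
rewrite !pt_letter; try lia.
rewrite /D_point (_ : (j == k.+1) = false) /=; last by lia.
rewrite xpair_eqE (@swapD j k.+1); try lia.
rewrite IHj ?(ltnW le_jk) //; last by rewrite /swap; do ![case: ifP => //=];
  lia.
by rewrite /swap; do ![case: ifP => //=]; lia.
Qed.

(** As a signed permutation, a Coxeter element of type D is a negative cycle of length [k + 1] times
    a negative cycle of length one; this lemma and the next describe the two parts. *)
Lemma D_cox a : a.1 <= k ->
  pt (iota c) a = ((if a.1 == k then 0 else a.1.+1), a.2 (+) (a.1 == k)).
Proof.
case: a => a e /= le_ak; rewrite /c /cox !iotaM !ptM !pt_letter //.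
rewrite D_run // /D_point eqxx /= (_ : (k == k.+1) = false) /=; last by lia.
rewrite swapK (_ : (a == k.+1) = false) ?orbF; last by lia.
by congr (_, _); do ![case: ifP => //=]; lia.
Qed.

Lemma D_cox_last d : pt (iota c) (k.+1, d) = (k.+1, ~~ d).
Proof.
rewrite /c /cox !iotaM !ptM !pt_letter // D_run // /D_point eqxx /=.
rewrite (_ : (k == k.+1) = false) /=; last by lia.
by rewrite swapK orbT addbT; congr (_, _); do ![case: ifP => //=]; lia.
Qed.

(** The letters of the path never cross the last point. When [a] is at [k], exactly one of the two
    leaves produces a crossing: [q] if the signs differ, [p] if they agree. *)
Lemma D_cox_cross a d : a.1 <= k -> cr (iota c) a (k.+1, d) = (a.1 == k).
Proof.
case: a => a e /= le_ak; rewrite /c /cox !iotaM !crM !ptM !pt_letter //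
  !cr_letter //.
rewrite /D_point eqxx /= (_ : (k == k.+1) = false) /=; last by lia.
rewrite D_run_cross //=.
- by rewrite /swap /= !xpair_eqE; do ![case: eqP => //=]; case: e;
  case: d => //=; lia.
- by rewrite /swap; do ![case: eqP => //=]; lia.
- by rewrite /swap; do ![case: eqP => //=]; lia.
Qed.

Lemma D_cox_pow t a d : a.1 <= k -> [/\
  pt (iota c ^+ t) a = ((a.1 + t) %% k.+1, a.2 (+) odd ((a.1 + t) %/ k.+1)),
  pt (iota c ^+ t) (k.+1, d) = (k.+1, d (+) odd t) &
  cr (iota c ^+ t) a (k.+1, d) = ((a.1 + t) %/ k.+1)%N].
Proof.
case: a => a e /= le_ak; elim: t => [|t [IH1 IH2 IH3]].
  rewrite !pt1 cr1 addn0 modn_small // divn_small //=.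
  by rewrite !addbF.
have lt_mod := ltn_pmod (a + t) (ltn0Sn k).
rewrite expgS !ptM crM IH1 IH2 IH3 D_cox //= D_cox_last D_cox_cross //=.
rewrite addnS modn_succ divn_succ oddD oddb; split; last by lia.
  by congr (_, _); rewrite -addbA; congr addb; rewrite addbC.
by rewrite addbN.
Qed.

Let neg (a : nat * bool) := (a.1, ~~ a.2).

Let negK : involutive neg.
Proof. by case=> a e; rewrite /neg /= negbK. Qed.

Let D_point_neg i a : D_point i (neg a) = neg (D_point i a).
Proof. by rewrite /D_point /neg; case: ifP => //= _; rewrite addNb. Qed.

Let pt_neg g a : pt g (neg a) = neg (pt g a).
Proof.
by have [->] := crossings_morph DK D_rel_ok (inv_inj negK) (fun i =>
  @D_point_neg i) g.
Qed.

Let cr_neg g a b : cr g (neg a) (neg b) = cr g a b.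
Proof.
by have [_ ->] := crossings_morph DK D_rel_ok (inv_inj negK) (fun i =>
  @D_point_neg i) g.
Qed.

(** A pair a, - a is excluded because the last letter can invert its order without exchanging its
    members. *)
Definition apart (a b : nat * bool) := [&& a.1 != b.1, a.1 < n & b.1 < n].

(* The order 0 < 1 < 2 < ... < - 2 < - 1 < - 0 of the signed points. *)
Definition signed_lt (a b : nat * bool) :=
  if a.2 then b.2 && (b.1 < a.1) else b.2 || (a.1 < b.1).

Let D_point_ltn (i : 'I_n) a : a.1 < n -> (D_point i a).1 < n.
Proof.
have := ltn_ord i; rewrite /D_point /swap.
by case: ifP => /= Ei; do ![case: ifP => //=]; lia.
Qed.

Let D_point_apart (i : 'I_n) a b : apart a b -> apart (D_point i a) (D_point i
  b).
Proof.
case/and3P=> neq_ab lt_an lt_bn; apply/and3P; split; [|exact: D_point_ltn..].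
by rewrite /D_point; case: ifP => /= _; rewrite (inj_eq (inv_inj (swapK _))).
Qed.

Let D_point_lt (i : 'I_n) a b : apart a b ->
  (D_point i a == b) = (signed_lt (D_point i a) (D_point i b) != signed_lt a b).
Proof.
case: a b => [a e] [b d]; rewrite /apart /D_point /signed_lt /=.
have lt_in := ltn_ord i.
case: ifP => /= _ /and3P[neq_ab lt_an lt_bn]; rewrite xpair_eqE /swap.
  by case: e; case: d; do ![case: eqP => //=]; lia.
by case: e; case: d; do ![case: eqP => //=]; lia.
Qed.

Let pt_ltn g a : a.1 < n -> (pt g a).1 < n.
Proof.
elim/pres_ind: g => u; rewrite (gpoint_class DK D_rel_ok) => lt_an.
by elim: u => //= -[i e] u; exact: D_point_ltn.
Qed.

Definition D_index g (i : 'I_n) : 'I_n := Ordinal (pt_ltn g (ltn_ord i : (i :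
  nat, false).1 < n)).

Definition D_sign g (i : 'I_n) := (pt g (i : nat, false)).2.

Let pt_index g (i : 'I_n) e :
  pt g (i : nat, e) = (D_index g i : nat, e (+) D_sign g i).
Proof.
rewrite /D_sign /=; case: e => /=; last by case: (pt g _).
by rewrite -[(_, true)]/(neg (i : nat, false)) pt_neg.
Qed.

Let D_index_inj g : injective (D_index g).
Proof.
move=> i j eq_ij; have := pt_index g i (D_sign g i (+) D_sign g j).
rewrite -addbA [D_sign g j (+) _]addbC addbA addbb addFb eq_ij.
rewrite -[D_sign g j]addFb -pt_index => /pt_inj[eq_val _]; exact: val_inj.
Qed.

(* Every letter changes the signs of an even number of points. *)
Let D_sign_even g : \big[addb/false]_(i < n) D_sign g i = false.
Proof.
elim/pres_ind: g => u; elim: u => [|[i e] u IHu].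
  by rewrite big1 // => j _; rewrite /D_sign (gpoint_class DK D_rel_ok).
pose g := pres_class (artin_relations (@diagram n lab)) u.
have signE j : D_sign (pres_class _ ((i, e) :: u)) j = D_sign g j (+)
    ((i == k.+1 :> nat) && ((D_index g j == k :> nat) || (D_index g j == k.+1
      :> nat))).
  rewrite {1}/D_sign (gpoint_class DK D_rel_ok) /= -(gpoint_class DK D_rel_ok)
    -/g.
  by rewrite pt_index /D_point; case: ifP => /=; rewrite ?addbF.
rewrite (eq_bigr _ (fun j _ => signE j)) big_split /= IHu addFb.
pose F (j : 'I_n) :=
  (i == k.+1 :> nat) && ((j == k :> nat) || (j == k.+1 :> nat)).
have <- : \big[addb/false]_(j < n) F j = \big[addb/false]_(j < n) F (D_index g
  j).
  by rewrite (reindex_inj (@D_index_inj g)).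
rewrite /F; case: (_ == _); last by rewrite big1.
rewrite big_ord_recr big_ord_recr /= big1 => [|j _].
  by rewrite !eqxx orbT /=; lia.
by have := ltn_ord j; lia.
Qed.

Lemma D_zeta_action a d : a.1 <= k ->
  [/\ pt (iota zeta) a = (a.1, a.2 (+) ~~ odd k),
      pt (iota zeta) (k.+1, d) = (k.+1, d (+) ~~ odd k) &
      cr (iota zeta) a (k.+1, d) = (odd k).+1].
Proof.
move=> le_ak; rewrite /zeta -expgnA iotaX mulnC.
have [-> -> ->] := D_cox_pow ((odd k).+1 * k.+1) d le_ak.
rewrite addnC modnMDl divnMDl // modn_small // divn_small // addn0.
by rewrite oddM /= oddb andbb.
Qed.

Lemma D_central_roots : central_roots (k.+1 * (odd k).+1) G.
Proof.
have zC := D_zeta_central; have z1 := D_zeta_neq1.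
apply: (gcentral_root (y := iota c) D_lab_gt1 D_cube D_connected zC z1).
  by rewrite iotaX iotaX expgnA.
apply: (mcentral_powers D_lab_gt1 D_cube D_connected zC z1) => g u l gC l_gt0
  Eg.
have g_letter i a : i < n -> pt g (D_point i a) = D_point i (pt g a).
  by move=> lt_in; rewrite -!pt_letter // -!ptM gC.
have moved i a : i < n -> (D_point i (pt g a) == pt g a) = (D_point i a == a).
  by move=> lt_in; rewrite -g_letter // (inj_eq (@pt_inj g)).
pose e := (pt g (k, false)).2.
(* Only the points of absolute value [k] are moved by both letters [k] and [k.-1], so [g] keeps this
   absolute value, though perhaps not the sign. *)
have gk : pt g (k, false) = (k, e).
  have [kk1 kk2] : (k == k.+1) = false /\ (k.-1 == k.+1) = false by split; lia.
  have lt_kn : k < n by exact: leqnSn.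
  have lt_k1n : k.-1 < n by lia.
  move: (moved k (k, false) lt_kn) (moved k.-1 (k, false) lt_k1n).
  rewrite /e; case: (pt g _) => [a d] /=; rewrite /D_point kk1 kk2 !xpair_eqE.
  have -> : swap k.-1 k = k.-1 by rewrite -{2}(prednK k_gt0) swapR.
  rewrite !eqxx !andbT /= swapL => m1 m2.
  congr (_, _); move: m1 m2; rewrite /swap; clear -k_gt0.
  by do ![case: eqP => //=]; lia.
have gk1 : pt g (k.+1, false) = (k.+1, e).
  have := g_letter k (k, false) (leqnSn _).
  by rewrite gk /D_point (_ : (k == k.+1) = false) /= ?swapL //; lia.
have [zk zk1 zkk] := @D_zeta_action (k, false) false (leqnn k).
(* Every iterate of the pair is the pair itself or its negative, and these have the same crossing
   number. *)
have iter_neg h d : pt h (k, false) = (k, d) -> pt h (k.+1, false) = (k.+1, d)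
  ->
    forall j, cr h (iter j (pt h) (k, false)) (iter j (pt h) (k.+1, false))
      = cr h (k, false) (k.+1, false).
  move=> hk hk1 j.
  have [f [-> ->]] : exists f, iter j (pt h) (k, false) = (k, f) /\
      iter j (pt h) (k.+1, false) = (k.+1, f).
    elim: j => [|j [f [/= -> ->]]]; first by exists false.
    case: f; last by rewrite hk hk1; exists d.
    rewrite -[(k, true)]/(neg (k, false)) -[(k.+1, true)]/(neg (k.+1, false)).
    by rewrite !pt_neg hk hk1; exists (~~ d).
  by case: f; rewrite // -[(k, true)]/(neg (k, false)) -(cr_neg h (k, false)).
have := congr1 (fun h => cr h (k, false) (k.+1, false)) Eg.
rewrite /= (crossingsX DK D_rel_ok _ (iter_neg _ _ gk gk1)).
rewrite (crossingsX DK D_rel_ok _ (iter_neg _ _ zk zk1)) zkk => El.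
(* The crossing number of [zeta] is 2 exactly when [k] is odd; only then must that of [g] be shown
   to be even. *)
have [v Ev] : exists v : int, cr g (k, false) (k.+1, false) = (v * (odd
  k).+1)%R.
  case: (boolP (odd k)) => [k_odd|_]; last first.
    by exists (cr g (k, false) (k.+1, false)); lia.
  have down m : m <= k -> pt g ((k - m)%N, false) = ((k - m)%N, e).
    elim: m => [|m IHm] lt_mk; first by rewrite subn0.
    have km : (k - m)%N = (k - m.+1).+1 by lia.
    have kk : (k - m.+1 == k.+1)%N = false by lia.
    have := g_letter (k - m.+1)%N ((k - m)%N, false).
    rewrite IHm ?(ltnW lt_mk) // /D_point kk /= km swapR => -> //; lia.
  have gi i : i <= k.+1 -> pt g (i, false) = (i, e).
    rewrite leq_eqVlt => /orP[/eqP->//|lt_ik].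
    by have := down (k - i)%N (leq_subr _ _); rewrite subKn.
  (* [g] gives the same sign to all [k + 2] points; their number is odd, while the number of sign
     changes is even. *)
  have e0 : e = false.
    have := D_sign_even g; rewrite (eq_bigr (fun=> e)) => [|j _]; last first.
      by rewrite /D_sign gi // -ltnS.
    rewrite big_const_ord; have k2_odd : odd k.+2 by rewrite /= negbK.
    case: (e) => //; suff -> m : iter m (addb true) false = odd m by rewrite
      k2_odd.
    by elim: m => //= m ->.
  have ab : apart (k, false) (k.+1, false) by apply/and3P; split => //=; lia.
  have [v] := crossings_parity DK D_rel_ok D_point_apart D_point_lt g ab.
  by rewrite gk gk1 e0 eqxx => ->; exists v; rewrite /=; lia.
apply/dvdnP; exists `|v|%N.
have {}El : (v * l = u)%R by move: El; rewrite Ev; case: (odd k) => /=; nia.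
by have := congr1 absz El; rewrite !abszM /=; lia.
Qed.

Lemma D_central_roots_bound m : central_roots m G -> m <= k.+1 * (odd k).+1.
Proof.
move=> roots; have [g Eg] : exists g : G, iota zeta = g ^+ m.
  by apply: roots; apply: mcentral_iota; exact: D_zeta_central.
pose z := iota c ^+ (k.+1).*2.
(* [z] fixes every signed point. It is [zeta] for odd [k] and the square of [zeta] for even [k], so
   [g] is a root of [z] of exponent [m] or 2 m. *)
have [K [Ez mK]] : exists K, g ^+ K = z /\ (K <= (k.+1).*2 -> m <= k.+1 * (odd
  k).+1).
  move: Eg; rewrite /zeta /z !iotaX -expgnA; case: (odd k) => Eg.
    exists m; split; first by rewrite -Eg; congr (_ ^+ _); lia.
    by move=> le; lia.
  exists m.*2; split; last by move=> le; lia.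
  by rewrite -!muln2 !expgnA -Eg !expgnA expg1.
apply: mK.
have zP a d : a.1 <= k ->
    [/\ pt z a = a, pt z (k.+1, d) = (k.+1, d) & cr z a (k.+1, d) = 2%R].
  move=> le_ak; rewrite /z; have [-> -> ->] := D_cox_pow (k.+1).*2 d le_ak.
  rewrite -mul2n addnC modnMDl divnMDl // modn_small // divn_small // addn0.
  by rewrite oddM /= !addbF; case: (a).
have bound a d L : a.1 <= k -> 0 < L -> iter L (pt g) a = a ->
    iter L (pt g) (k.+1, d) = (k.+1, d) -> K <= L.
  move=> le_ak L_gt0 ga gb; have [za zb zab] := zP a d le_ak.
  apply: (root_bound DK D_rel_ok D_point_apart D_point_lt Ez _ L_gt0 za zb zab
    ga gb).
  by apply/and3P; split=> //=; [rewrite ltn_eqF|exact: leqW].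
pose F := D_index g.
have F_inj : injective F := @D_index_inj g.
have iterF j (i : 'I_n) e : exists f, iter j (pt g) (i : nat, e) = (iter j F i
  : nat, f).
  elim: j => [|j [f /= ->]]; first by exists e.
  by rewrite pt_index; eexists.
have iterN j a : iter j (pt g) (neg a) = neg (iter j (pt g) a).
  by elim: j => //= j ->; rewrite pt_neg.
(* One turn of a cycle of absolute values may change the sign; two turns do not. *)
have double (i : 'I_n) e L : iter L F i = i ->
    iter L.*2 (pt g) (i : nat, e) = (i : nat, e).
  move=> FL; have [f Ef] := iterF L i false.
  have Ef' e' : iter L (pt g) (i : nat, e') = (i : nat, e' (+) f).
    case: e'; last by rewrite Ef FL.
    by rewrite -[(_, true)]/(neg (i : nat, false)) iterN Ef FL.
  by rewrite -addnn iterD !Ef' -addbA addbb addbF.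
have order_pos i : 0 < order F i by rewrite order_gt0.
have order_lt i j : iter (order F j) F j = j -> ~~ fconnect F i j -> order F i
  <= k.+1.
  move=> _ nij; have : #|fconnect F i| <= #|predC1 j|.
    by apply/subset_leq_card/subsetP => y; rewrite !inE;
      apply: contraTneq => ->.
  by rewrite cardC1 card_ord.
have [Fmax|Fmax] := eqVneq (F ord_max) ord_max.
  have le_ord : order F ord0 <= k.+1.
    apply: (order_lt _ ord_max); first exact: iter_order.
    rewrite fconnect_sym //; apply/negP => /iter_findex.
    by rewrite iter_fix // => /(congr1 val).
  apply: (@leq_trans (order F ord0).*2); last by lia.
  apply: (bound (0, false) false) => //; first by rewrite double_gt0.
    by apply: (double ord0); rewrite iter_order.
  by apply: (double ord_max); rewrite iter_fix.
have le_F : (F ord_max <= k)%N.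
  have := ltn_ord (F ord_max); rewrite ltnS leq_eqVlt => /orP[/eqP EF|//].
  by case/eqP: Fmax; apply: val_inj.
pose a := pt g (k.+1, false).
have aE : a = (F ord_max : nat, D_sign g ord_max) by exact: (pt_index g ord_max
  false).
have cycle L : 0 < L -> iter L (pt g) (k.+1, false) = (k.+1, false) -> K <= L.
  move=> L_gt0 gL; apply: (bound a false) => //.
  by rewrite /a -iterSr /= gL.
have [lt_ord|ge_ord] := leqP (order F ord_max) k.+1.
  apply: (@leq_trans (order F ord_max).*2); last by lia.
  apply: cycle; first by rewrite double_gt0.
  by apply: (double ord_max); rewrite iter_order.
have ord_n : order F ord_max = n.
  by apply/eqP; rewrite eqn_leq ge_ord andbT -[X in _ <= X]card_ord max_card.
(* For a cycle through all [k + 2] absolute values, doubling would exceed the bound. One turn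
   suffices, as the sign it collects is the product of all signs, which is trivial by
   [D_sign_even]. *)
apply: (@leq_trans (order F ord_max)); last by rewrite ord_n; lia.
apply: cycle => //.
have iter_sign j : iter j (pt g) (k.+1, false) =
    (iter j F ord_max : nat, \big[addb/false]_(i <- traject F ord_max j) D_sign
      g i).
  elim: j => [|j IHj]; first by rewrite big_nil.
  rewrite iterS IHj pt_index trajectSr -cats1 big_cat big_seq1 //.
rewrite iter_sign iter_order // -/(orbit F ord_max).
rewrite (perm_big (index_enum 'I_n)) ?D_sign_even //=.
apply: uniq_perm; [exact: orbit_uniq|exact: index_enum_uniq|move=> i].
rewrite mem_index_enum -fconnect_orbit.
have cardE : #|fconnect F ord_max| = #|'I_n| by rewrite card_ord; exact: ord_n.
exact: (subset_cardP cardE (subset_predT _) i).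
Qed.

End TypeD.

(** * Elementary theories *)

Local Close Scope quotient_scope.
Local Close Scope group_scope.

Lemma Th_eq_AEA1 (G H : groupType) : Th G = Th H -> Th_AEA1 G = Th_AEA1 H.
Proof. by rewrite /Th_AEA1 => ->. Qed.

(** Assuming [b < a] makes [a] at least 2, so the exceptional index 1 only ever appears on the side
    of the upper bound. *)
Lemma Th_AEA1_A n m : 1 <= n -> 1 <= m ->
  Th_AEA1 (artin_A n) = Th_AEA1 (artin_A m) -> n = m.
Proof.
have main a b : 1 <= a -> 1 <= b ->
    Th_AEA1 (artin_A a) = Th_AEA1 (artin_A b) -> a <= b.
  move=> a_gt0 b_gt0 eqTh; rewrite leqNgt; apply/negP => lt_ba.
  have := A_central_roots_bound b_gt0
    (Th_AEA1_central_roots eqTh (A_central_roots (leq_ltn_trans b_gt0 lt_ba))).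
  by rewrite ltnS leqNgt lt_ba.
move=> n_gt0 m_gt0 eqTh; apply/eqP; rewrite eqn_leq.
by rewrite (main _ _ n_gt0 m_gt0 eqTh) (main _ _ m_gt0 n_gt0 (esym eqTh)).
Qed.

Lemma Th_AEA1_B n m : 2 <= n -> 2 <= m ->
  Th_AEA1 (artin_B n) = Th_AEA1 (artin_B m) -> n = m.
Proof.
have main a b : 2 <= a -> 2 <= b ->
    Th_AEA1 (artin_B a) = Th_AEA1 (artin_B b) -> a <= b.
  case: a => // a a_gt0 b_gt1 eqTh; apply: B_central_roots_bound b_gt1 _.
  exact: Th_AEA1_central_roots eqTh (B_central_roots a_gt0).
move=> n_gt1 m_gt1 eqTh; apply/eqP; rewrite eqn_leq.
by rewrite (main _ _ n_gt1 m_gt1 eqTh) (main _ _ m_gt1 n_gt1 (esym eqTh)).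
Qed.

Lemma Th_AEA1_D n m : 3 <= n -> 3 <= m ->
  Th_AEA1 (artin_D n) = Th_AEA1 (artin_D m) -> n = m.
Proof.
pose K a := a.-1 * (odd a).+1.
have main a b : 3 <= a -> 3 <= b ->
    Th_AEA1 (artin_D a) = Th_AEA1 (artin_D b) -> K a <= K b.
  case: a => [|[|a]] // a_gt0; case: b => [|[|b]] // b_gt0 eqTh.
  have := D_central_roots_bound b_gt0
    (Th_AEA1_central_roots eqTh (D_central_roots a_gt0)).
  by rewrite /K /= !negbK.
move=> n_gt2 m_gt2 eqTh; have : K n = K m.
  apply/eqP; rewrite eqn_leq.
  by rewrite (main _ _ n_gt2 m_gt2 eqTh) (main _ _ m_gt2 n_gt2 (esym eqTh)).
(* [K] separates the parities: it is odd for even arguments and divisible by 4 for odd ones; on each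
   parity class it is injective. *)
rewrite /K; have := odd_double_half n; have := odd_double_half m.
by case: (odd n); case: (odd m) => /=; lia.
Qed.

Lemma Th_AEA1_I2_odd n m : 3 <= n -> 3 <= m -> odd m -> odd n ->
  Th_AEA1 (artin_I2 n) = Th_AEA1 (artin_I2 m) -> m = n.
Proof.
have main a b : 3 <= a -> 3 <= b -> odd b -> odd a ->
    Th_AEA1 (artin_I2 a) = Th_AEA1 (artin_I2 b) -> a <= b.
  move=> a_gt2 b_gt2 b_odd a_odd eqTh; have := I2_central_roots a_gt2.
  rewrite a_odd => /(Th_AEA1_central_roots eqTh)/(I2_central_roots_dvd b_gt2).
  (* The letter count only gives that [a] divides 2 b; as [a] is odd, it divides [b]. *)
  rewrite b_odd -muln2 Gauss_dvdl ?coprimen2 // => /dvdn_leq; apply.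
  exact: ltnW (ltnW _).
move=> n_gt2 m_gt2 m_odd n_odd eqTh.
apply/eqP; rewrite eqn_leq (main _ _ n_gt2 m_gt2 m_odd n_odd eqTh).
by rewrite (main _ _ m_gt2 n_gt2 n_odd m_odd (esym eqTh)).
Qed.

(** Whatever the parity of [m], the exponent [m] or m / 2 available for it exceeds n / 2, which
    every exponent valid for the even index [n] must divide. *)
Lemma Th_AEA1_I2_even n m : 3 <= n -> 3 <= m -> ~~ odd n -> n < m ->
  Th_AEA1 (artin_I2 m) <> Th_AEA1 (artin_I2 n).
Proof.
move=> n_gt2 m_gt2 n_even lt_nm eqTh.
have := I2_central_roots_dvd n_gt2
  (Th_AEA1_central_roots eqTh (I2_central_roots m_gt2)).
rewrite (negPf n_even) => /dvdn_leq.
by have := odd_double_half m; case: (odd m); lia.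
Qed.

Lemma Th_AEA1_I2_even_eq n m : 3 <= n -> 3 <= m -> ~~ odd m -> ~~ odd n ->
  Th_AEA1 (artin_I2 n) = Th_AEA1 (artin_I2 m) -> m = n.
Proof.
move=> n_gt2 m_gt2 m_even n_even eqTh; case: (ltngtP m n) => // [lt_mn|lt_nm].
- by case: (Th_AEA1_I2_even m_gt2 n_gt2 m_even lt_mn).
- by case: (Th_AEA1_I2_even n_gt2 m_gt2 n_even lt_nm).
Qed.

Theorem theorem4p1 :
  [/\ forall n m : nat, 1 <= n -> 1 <= m ->
        (Th (artin_A n) = Th (artin_A m) <-> n = m),
      forall n m : nat, 2 <= n -> 2 <= m ->
        (Th (artin_B n) = Th (artin_B m) <-> n = m),
      forall n m : nat, 3 <= n -> 3 <= m ->
        (Th (artin_D n) = Th (artin_D m) <-> n = m)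
    & [/\ forall n m : nat, 3 <= n -> 3 <= m -> odd m -> odd n ->
            (Th (artin_I2 n) = Th (artin_I2 m) <-> m = n),
          forall n m : nat, 3 <= n -> 3 <= m -> ~~ odd m -> ~~ odd n ->
            (Th (artin_I2 n) = Th (artin_I2 m) <-> m = n)
        & forall n m : nat, 3 <= n -> 3 <= m -> ~~ odd n -> n < m ->
            Th (artin_I2 m) <> Th (artin_I2 n)]]
  /\
  [/\ forall n m : nat, 1 <= n -> 1 <= m ->
        (Th_AEA1 (artin_A n) = Th_AEA1 (artin_A m) <-> n = m),
      forall n m : nat, 2 <= n -> 2 <= m ->
        (Th_AEA1 (artin_B n) = Th_AEA1 (artin_B m) <-> n = m),
      forall n m : nat, 3 <= n -> 3 <= m ->
        (Th_AEA1 (artin_D n) = Th_AEA1 (artin_D m) <-> n = m)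
    & [/\ forall n m : nat, 3 <= n -> 3 <= m -> odd m -> odd n ->
            (Th_AEA1 (artin_I2 n) = Th_AEA1 (artin_I2 m) <-> m = n),
          forall n m : nat, 3 <= n -> 3 <= m -> ~~ odd m -> ~~ odd n ->
            (Th_AEA1 (artin_I2 n) = Th_AEA1 (artin_I2 m) <-> m = n)
        & forall n m : nat, 3 <= n -> 3 <= m -> ~~ odd n -> n < m ->
            Th_AEA1 (artin_I2 m) <> Th_AEA1 (artin_I2 n)]].
Proof.
split; split.
- move=> n m n1 m1; split=> [/Th_eq_AEA1|->]; last reflexivity.
  exact: Th_AEA1_A.
- move=> n m n1 m1; split=> [/Th_eq_AEA1|->]; last reflexivity.
  exact: Th_AEA1_B.
- move=> n m n1 m1; split=> [/Th_eq_AEA1|->]; last reflexivity.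
  exact: Th_AEA1_D.
- split=> n m n1 m1.
  + move=> om on; split=> [/Th_eq_AEA1|->]; last reflexivity.
    exact: Th_AEA1_I2_odd.
  + move=> om on; split=> [/Th_eq_AEA1|->]; last reflexivity.
    exact: Th_AEA1_I2_even_eq.
  + by move=> en lt_nm /Th_eq_AEA1; apply: Th_AEA1_I2_even.
- move=> n m n1 m1; split=> [|->]; last reflexivity.
  exact: Th_AEA1_A.
- move=> n m n1 m1; split=> [|->]; last reflexivity.
  exact: Th_AEA1_B.
- move=> n m n1 m1; split=> [|->]; last reflexivity.
  exact: Th_AEA1_D.
- split=> n m n1 m1.
  + move=> om on; split=> [|->]; last reflexivity.
    exact: Th_AEA1_I2_odd.
  + move=> om on; split=> [|->]; last reflexivity.
    exact: Th_AEA1_I2_even_eq.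
  + by move=> en lt_nm; apply: Th_AEA1_I2_even.
Qed.
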